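(* Let $k\ge1$ and $0<\epsilon<1$ be fixed. Let $G$ be a finite group of order $n>10^6\left(\frac{k}{\epsilon}\right)^8$, let $m=\left\lceil\frac{9k^2\log D(G)}{\epsilon^2}\right\rceil$ (natural logarithm), and let $A$ be a uniformly random $m$-element subset of $G$. Then \[ \Pr\big[\mu_{k-1}(Y_{A,k})<(1-\epsilon)m\big]<\frac{6}{n}. \]
   Context: $D(G)=\sum_{\rho}d_\rho$, the sum of the degrees of the (pairwise non-isomorphic) complex irreducible representations $\rho$ of $G$. Let $G$ be a finite group of order $n$ and $k\ge1$. For $1\le i\le k+1$ let $V_i=\{i\}\times G$, viewed as a $0$-dimensional complex. $Y_{G,k}$ denotes the simplicial join $V_1*\cdots*V_{k+1}$, i.e. the simplicial complex on vertex set $V_1\cup\cdots\cup V_{k+1}$ whose simplices are the sets containing at most one vertex from each $V_i$. For $A\subset G$, $Y_{A,k}$ is the subcomplex of $Y_{G,k}$ containing the full $(k-1)$-skeleton of $Y_{G,k}$ and whose $k$-simplices are the sets $\{(1,x_1),\ldots,(k+1,x_{k+1})\}$ with $x_1x_2\cdots x_{k+1}\in A$. For a simplicial complex $X$ and $j\ge0$, $C^j(X)$ is the real vector space of real-valued skew-symmetric functions on ordered $j$-simplices, $C^{-1}(X)=\mathbb R$; the coboundary $d_j:C^j\to C^{j+1}$ is $d_j\phi([v_0,\dots,v_{j+1}])=\sum_i(-1)^i\phi([v_0,\dots,\widehat{v_i},\dots,v_{j+1}])$, and $d_{-1}(a)(v)=a$. Each $C^j(X)$ has the standard inner product $(\phi,\psi)_X=\sum_{\sigma\in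 X(j)}\phi(\sigma)\psi(\sigma)$, and $d_j^*$ denotes the adjoint. The reduced $j$-th Laplacian is $L_j(X)=d_{j-1}d_{j-1}^*+d_j^*d_j$ on $C^j(X)$, and $\mu_j(X)$ denotes its minimal eigenvalue. *)

(* Defs.v *)
From HB Require Import structures.
From mathcomp Require Import all_boot all_order all_algebra all_fingroup all_field all_character.
From mathcomp Require Import boolp classical_sets reals exp.
Set Implicit Arguments. Unset Strict Implicit. Unset Printing Implicit Defensive.
Import Order.TTheory GRing.Theory Num.Theory.
Local Open Scope ring_scope.

Definition DG (gT : finGroupType) : nat :=
  (\sum_(i : Iirr [set: gT]%G) Num.truncn ('chi[[set: gT]%G]_i 1%g : algC))%N.

(* Vertex set of Y_{G,k}: V_1 u ... u V_{k+1}, V_i = {i} x G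
   (colours i indexed by 'I_(k+1)). *)
Definition vtx (k : nat) (gT : finGroupType) := ('I_k.+1 * gT)%type.

(* A set of vertices is a simplex of the join iff it contains at most one
   vertex of each colour. *)
Definition colorful k (gT : finGroupType) (S : {set vtx k gT}) : bool :=
  [forall v in S, forall w in S, (v.1 == w.1) ==> (v == w)].

Definition eltc k (gT : finGroupType) (S : {set vtx k gT}) (i : 'I_k.+1) : gT :=
  odflt 1%g [pick g | (i, g) \in S].

Definition prodS k (gT : finGroupType) (S : {set vtx k gT}) : gT :=
  (\prod_(i < k.+1) eltc S i)%g.

(* faces of Y_{A,k} with exactly p vertices (i.e. (p-1)-simplices; p = 0 is
   the empty face, indexing C^{-1} = R): the full (k-1)-skeleton of the join,
   plus the k-simplices whose product lies in A. *)
Definition faceY k (gT : finGroupType) (A : {set gT}) (p : nat) : {set {set vtx k gT}} :=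
  [set S | [&& colorful S, #|S| == p & (p == k.+1) ==> (prodS S \in A)]].

Section Cochains.
Variables (R : realType) (V : finType).

(* Incidence coefficient [tau : sigma]: each simplex of the join is oriented
   canonically by increasing colour; if tau = sigma u {v} (v not in sigma),
   the coefficient is (-1)^i where v is the i-th vertex (from 0) of tau in
   that order, i.e. i = #{w in tau | colour w < colour v}. *)
Definition inc (col : V -> nat) (tau sigma : {set V}) : R :=
  if (sigma \subset tau) && (#|tau| == #|sigma|.+1) then
    match [pick v in tau :\: sigma] with
    | Some v => (-1) ^+ #|[set w in tau | (col w < col v)%N]|
    | None => 0
    end
  else 0.

(* A cochain with p vertices per face is a real function on sets of vertices
   supported on the faces F p (canonical-orientation coordinates). *)
Variables (col : V -> nat) (F : nat -> {set {set V}}).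

(* coboundary d_{p-1} : C^{p-1} -> C^p *)
Definition cob (p : nat) (phi : {set V} -> R) : {set V} -> R :=
  fun tau => if tau \in F p.+1 then \sum_(sigma in F p) inc col tau sigma * phi sigma
             else 0.

Definition cobadj (p : nat) (psi : {set V} -> R) : {set V} -> R :=
  fun sigma => if sigma \in F p then \sum_(tau in F p.+1) inc col tau sigma * psi tau
               else 0.

(* reduced Laplacian on cochains of faces with p >= 1 vertices, i.e. L_{p-1} *)
Definition lap (p : nat) (phi : {set V} -> R) : {set V} -> R :=
  fun S => cob p.-1 (cobadj p.-1 phi) S + cobadj p (cob p phi) S.

Definition eigs (p : nat) : set R :=
  [set l : R | exists phi : {set V} -> R,
     [/\ forall S, S \notin F p -> phi S = 0,
         exists S, phi S != 0 &
         forall S, lap p phi S = l * phi S]].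

Definition mineig (p : nat) : R := inf (eigs p).
End Cochains.

Definition muY (R : realType) (k : nat) (gT : finGroupType) (A : {set gT}) : R :=
  @mineig R (vtx k gT) (fun v : vtx k gT => nat_of_ord v.1) (@faceY k gT A) k.

(* Main.v *)
Require Import Defs.
From HB Require Import structures.
From mathcomp Require Import all_boot all_order all_algebra all_fingroup all_field all_character.
From mathcomp Require Import boolp classical_sets reals exp.
From mathcomp Require Import sequences complex ring lra zify.
Set Implicit Arguments. Unset Strict Implicit. Unset Printing Implicit Defensive.
Import Order.TTheory GRing.Theory Num.Theory.
Local Open Scope ring_scope.

(* Write a cochain phi on (k-1)-faces as functions psi_i on G^(k+1) not depending on x_i.
   In |d phi|^2 the diagonal terms give m |phi|^2; for i <> j the cross term is a bilinear form
   with kernel [a g b h c in A] in two coordinates, which splits into the constant kernel m/n,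
   compensated by |d^* phi|^2 because m <= n, and the centred kernel [gh in A] - m/n. Hence the
   least eigenvalue is at least m - k th as soon as the centred convolution operator of A has
   norm at most th, and it remains to bound its norm by th = eps m / k.

   The dilated operator is S_A = sum_(a in A) X_a with symmetric contractions X_a of size 2n
   summing to 0 over G. The method of exchangeable pairs, applied to swapping an element of A
   with one outside A, gives E tr S_A^(2q+2) <= (2q+1) m E tr S_A^(2q) when 2q+1 <= m, so
   E tr S_A^(2q) <= 2n (2q-1)!! m^q. Markov's inequality with q = floor(t/2), where
   t = m eps^2 / k^2 >= 9 ln D(G) >= (9/2) ln n since D(G)^2 >= n, gives the tail bound. No
   representation theory beyond the last inequality enters. *)

(** * Moments of sums over random subsets *)

Section Trace.
Variable R : realFieldType.

Definition frob {d e} (A B : 'M[R]_(d, e)) : R := \sum_i \sum_j A i j * B i j.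

Lemma frobE d e (A B : 'M[R]_(d, e)) : frob A B = \tr (A^T *m B).
Proof.
rewrite /frob /mxtrace exchange_big /=; apply: eq_bigr => j _.
by rewrite mxE; apply: eq_bigr => i _; rewrite mxE.
Qed.

Lemma frob_ge0 d e (A : 'M[R]_(d, e)) : 0 <= frob A A.
Proof. by apply: sumr_ge0 => i _; apply: sumr_ge0 => j _; rewrite -expr2 sqr_ge0. Qed.

Lemma frob_amgm d e (A B : 'M[R]_(d, e)) : 2 * frob A B <= frob A A + frob B B.
Proof.
rewrite /frob mulr_sumr -big_split; apply: ler_sum => i _.
rewrite mulr_sumr -big_split; apply: ler_sum => j _ /=.
by rewrite -subr_ge0 (_ : _ - _ = (A i j - B i j) ^+ 2) ?sqr_ge0 //; ring.
Qed.

(** Increments of a convex sequence are nondecreasing, so moving the indices [a] and [h - a] apart,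
    symmetrically, can only increase the sum. Indices beyond the middle follow by reflection. *)
Lemma convex_ends (h : nat) (x : nat -> R) :
  (forall a, (a.+2 <= h)%N -> 2 * x a.+1 <= x a + x a.+2) ->
  forall a, (a <= h)%N -> x a + x (h - a)%N <= x 0%N + x h.
Proof.
move=> cvx.
have incr a b : (a <= b)%N -> (b < h)%N -> x a.+1 - x a <= x b.+1 - x b.
  elim: b => [|b IH]; first by rewrite leqn0 => /eqP ->.
  rewrite leq_eqVlt => /orP[/eqP -> //|ab] bh.
  have := IH ab (ltnW bh); have := cvx b bh; lra.
have half a : (a.*2 <= h)%N -> x a + x (h - a)%N <= x 0%N + x h.
  elim: a => [|a IH] ah; first by rewrite subn0.
  have := IH ltac:(lia).
  have := incr a (h - a.+1)%N; rewrite -subSn ?subSS; last by lia.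
  move=> /(_ ltac:(lia) ltac:(lia)); lra.
move=> a ah; have [le|gt] := leqP a.*2 h; first exact: half.
have := half (h - a)%N ltac:(lia); rewrite subKn //; lra.
Qed.

(** The terms at s and 2h - s are paired. Even indices form a convex sequence; an odd s, and
    likewise 2h - s, is the midpoint of two neighbouring even indices, which reduces it to the even
    case. *)
Lemma pairing_sum_le (h : nat) (t : nat -> R) :
  (forall a b, (a <= h)%N -> (b <= h)%N -> 2 * t (a + b)%N <= t a.*2 + t b.*2) ->
  2 * (\sum_(s < h.*2.+1) t s) <= h.*2.+1%:R * (t 0%N + t h.*2).
Proof.
move=> mid.
have ends a : (a <= h)%N -> t a.*2 + t (h - a).*2 <= t 0%N + t h.*2.
  move=> ah; apply: (@convex_ends h (fun a => t a.*2)) => // b bh.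
  have := mid b b.+2 ltac:(lia) ltac:(lia).
  by rewrite (_ : (b + b.+2)%N = b.+1.*2) //; lia.
have pair s : (s <= h.*2)%N -> t s + t (h.*2 - s)%N <= t 0%N + t h.*2.
  move=> sh; have := odd_double_half s; case: (odd s) => /= es.
    have := mid s./2 s./2.+1 ltac:(lia) ltac:(lia).
    have := mid (h - s./2)%N (h - s./2.+1)%N ltac:(lia) ltac:(lia).
    rewrite (_ : (s./2 + s./2.+1)%N = s); last by lia.
    rewrite (_ : (h - s./2 + _)%N = (h.*2 - s)%N); last by lia.
    have := ends s./2 ltac:(lia); have := ends s./2.+1 ltac:(lia).
    lra.
  have := ends s./2 ltac:(lia); rewrite doubleB -es add0n !doubleK; lra.
rewrite mulr_natl mulr2n {2}(reindex_inj rev_ord_inj) -big_split /=.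
have -> : h.*2.+1%:R * (t 0%N + t h.*2) = \sum_(s < h.*2.+1) (t 0%N + t h.*2).
  by rewrite sumr_const card_ord mulr_natl.
by apply: ler_sum => s _; rewrite subSS; apply: pair; rewrite -ltnS.
Qed.

(** Telescoping; [A] and [B] need not commute, so [A - B] stays between the powers. *)
Lemma subrXX_nc (T : pzRingType) (A B : T) n :
  A ^+ n.+1 - B ^+ n.+1 = \sum_(s < n.+1) A ^+ s * (A - B) * B ^+ (n - s).
Proof.
elim: n => [|n IH]; first by rewrite big_ord1 !expr0 !expr1 mul1r mulr1.
rewrite big_ord_recl expr0 mul1r subn0.
under eq_bigr => s _ do rewrite /= /bump /= add1n subSS exprS -!mulrA.
rewrite -mulr_sumr; under eq_bigr => s _ do rewrite mulrA.
by rewrite -IH mulrBl mulrBr -!exprS [RHS]addrC addrA subrK.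
Qed.

Lemma trmxX d (A : 'M[R]_d) n : (A ^+ n)^T = A^T ^+ n.
Proof. by elim: n => [|n IH]; rewrite ?expr0 ?trmx1 // exprS exprSr trmx_mul IH. Qed.

(* With t s = tr (H A^s H B^(2h-s)), Cauchy-Schwarz gives t (a+b) <= (t (2a) + t (2b)) / 2,
   so the even terms are convex and every pair t s + t (2h-s) is at most t 0 + t (2h). *)
Lemma trace_mean_value d (A B : 'M[R]_d) h : A^T = A -> B^T = B ->
  2 * \tr ((A - B) * (A ^+ h.*2.+1 - B ^+ h.*2.+1))
    <= h.*2.+1%:R * \tr ((A - B) * (A - B) * (A ^+ h.*2 + B ^+ h.*2)).
Proof.
move=> sA sB; set H := A - B.
have sH : H^T = H by rewrite /H raddfB /= sA sB.
pose t s := \tr (H * A ^+ s * H * B ^+ (h.*2 - s)).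
have -> : \tr (H * (A ^+ h.*2.+1 - B ^+ h.*2.+1)) = \sum_(s < h.*2.+1) t s.
  rewrite subrXX_nc mulr_sumr raddf_sum; apply: eq_bigr => s _.
  by rewrite /t /= !mulrA.
have -> : \tr (H * H * (A ^+ h.*2 + B ^+ h.*2)) = t 0%N + t h.*2.
  rewrite /t expr0 mulr1 subn0 subnn expr0 mulr1 mulrDr raddfD addrC; congr (_ + _).
  by rewrite -mulrA [LHS]mxtrace_mulC.
apply: pairing_sum_le => a b ah bh.
have fE x y : (x <= h)%N -> (y <= h)%N ->
    frob (A ^+ x * H * B ^+ (h - x)) (A ^+ y * H * B ^+ (h - y)) = t (x + y)%N.
  move=> xh yh; rewrite frobE !trmx_mul !trmxX sA sB sH mulmxE mulrA.
  rewrite [LHS]mxtrace_mulC mulmxE /t !mulrA exprD.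
  rewrite [RHS]mxtrace_mulC mulmxE -addnn (_ : (h + h - (x + y) = (h - y) + (h - x))%N); last by lia.
  by rewrite exprD !mulrA.
have := frob_amgm (A ^+ a * H * B ^+ (h - a)) (A ^+ b * H * B ^+ (h - b)).
by rewrite !fE // !addnn.
Qed.
End Trace.

Section Moments.
Variables (R : realFieldType) (d : nat) (I : finType) (X : I -> 'M[R]_d).
Hypothesis symX : forall a, (X a)^T = X a.
Hypothesis contrX : forall a (Y : 'M[R]_d), frob (X a *m Y) (X a *m Y) <= frob Y Y.
Hypothesis sumX : \sum_a X a = 0.

Definition subsum (A : {set I}) : 'M[R]_d := \sum_(a in A) X a.
Definition moment (m q : nat) : R := \sum_(A : {set I} | #|A| == m) \tr (subsum A ^+ q.*2).

Lemma subsum_sym A : (subsum A)^T = subsum A.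
Proof. by rewrite /subsum raddf_sum; apply: eq_bigr => a _ /=. Qed.

Lemma sum_compl (A : {set I}) : \sum_(b in ~: A) X b = - subsum A.
Proof.
apply/eqP; rewrite -subr_eq0 opprK addrC; apply/eqP; rewrite -[RHS]sumX.
rewrite [RHS](bigID (mem A)) /=; congr (_ + _).
by apply: eq_bigl => b; rewrite inE.
Qed.

(** The complement of [A] sums to [- subsum A], so both halves of the difference are multiples of
    [subsum A], with weights adding up to [#|I|]. This is the linear regression property that the
    method of exchangeable pairs requires. *)
Lemma sum_exchange (A : {set I}) : \sum_(a in A) \sum_(b in ~: A) (X a - X b) = subsum A *+ #|I|.
Proof.
under eq_bigr => a _ do rewrite sumrB sum_compl opprK sumr_const.
rewrite big_split /= sumr_const sumrMnl -/(subsum A) -mulrnDr.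
by rewrite addnC cardsC.
Qed.

Lemma sum_exchange2 (A : {set I}) :
  \sum_(a in A) \sum_(b in ~: A) (X a - X b) * (X a - X b)
  = (\sum_(a in A) X a * X a) *+ #|~: A| + (\sum_(b in ~: A) X b * X b) *+ #|A|
    + (subsum A * subsum A) *+ 2.
Proof.
have inner a : \sum_(b in ~: A) (X a - X b) * (X a - X b)
   = X a * X a *+ #|~: A| + \sum_(b in ~: A) X b * X b + (X a * subsum A + subsum A * X a).
  have E b : (X a - X b) * (X a - X b) = X a * X a + X b * X b - (X a * X b + X b * X a).
    by rewrite mulrBl !mulrBr opprB opprD addrACA.
  under eq_bigr => b _ do rewrite E.
  rewrite sumrB !big_split /= sumr_const -mulr_sumr -mulr_suml !sum_compl.
  by rewrite mulrN mulNr -opprD opprK.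
under eq_bigr => a _ do rewrite inner.
rewrite !big_split /= sumrMnl sumr_const -mulr_suml -mulr_sumr -/(subsum A).
by rewrite mulr2n.
Qed.

(** Since S = [subsum A] is symmetric, the left side is the squared Frobenius norm of X_a S^q, so
    the contraction property applies with Y = S^q. *)
Lemma trace_contr a A q : \tr (X a * X a * subsum A ^+ q.*2) <= \tr (subsum A ^+ q.*2).
Proof.
have := contrX a (subsum A ^+ q).
rewrite !frobE trmx_mul trmxX subsum_sym symX !mulmxE -exprD addnn.
by rewrite -!mulrA [X in X <= _]mxtrace_mulC mulmxE -!mulrA -exprD addnn.
Qed.

(** In [sum_exchange2] the squares X_a^2 and X_b^2 are controlled by contraction, while the mixed
    products add up to 2 S^2 and raise the exponent of the trace by two. *)
Lemma exchange_trace_le (A : {set I}) q :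
  \sum_(a in A) \sum_(b in ~: A) \tr ((X a - X b) * (X a - X b) * subsum A ^+ q.*2)
  <= 2 * (#|A| * #|~: A|)%:R * \tr (subsum A ^+ q.*2) + 2 * \tr (subsum A ^+ q.+1.*2).
Proof.
have -> : \sum_(a in A) \sum_(b in ~: A) \tr ((X a - X b) * (X a - X b) * subsum A ^+ q.*2)
  = \tr ((\sum_(a in A) \sum_(b in ~: A) (X a - X b) * (X a - X b)) * subsum A ^+ q.*2).
  rewrite mulr_suml raddf_sum; apply: eq_bigr => a _ /=.
  by rewrite mulr_suml raddf_sum.
rewrite sum_exchange2 mulrDl mulrDl 2!mxtraceD.
have -> : \tr (subsum A * subsum A *+ 2 * subsum A ^+ q.*2) = 2 * \tr (subsum A ^+ q.+1.*2).
  by rewrite mulrnAl raddfMn /= mulr_natl -mulrA -!exprS doubleS.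
rewrite lerD2r !mulrnAl !raddfMn /= !mulr_suml !raddf_sum /=.
have bound (B : {set I}) : \sum_(a in B) \tr (X a * X a * subsum A ^+ q.*2)
    <= #|B|%:R * \tr (subsum A ^+ q.*2).
  rewrite mulr_natl -sumr_const; apply: ler_sum => a _; exact: trace_contr.
have := ler_wMn2r #|A| (bound (~: A)); have := ler_wMn2r #|~: A| (bound A).
move: (\tr _) (\sum_(a in A) _) (\sum_(b in ~: A) _) => W s1 s2.
rewrite -(mulr_natr s1) -(mulr_natr s2) -!(mulr_natr (_ * W)) natrM.
by move: (#|A|%:R : R) (#|~: A|%:R : R) => a b; lra.
Qed.

(* Swapping a in A with b outside A is an involution on triples (A, a, b) that changes the
   partial sum S_A by -(X a - X b); as the X sum to 0, the average of X a - X b over all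
   swaps of A is proportional to S_A. *)
Lemma moment_exchange m q : (m <= #|I|)%N ->
  #|I|%:R * moment m q.+1
  <= q.*2.+1%:R * ((m * (#|I| - m))%:R * moment m q + moment m q.+1).
Proof.
move=> mn; pose T := ({set I} * I * I)%type.
pose P (t : T) := [&& #|t.1.1| == m, t.1.2 \in t.1.1 & t.2 \in ~: t.1.1].
pose swap (t : T) : T := (t.2 |: t.1.1 :\ t.1.2, t.2, t.1.2).
have triple (F : {set I} -> I -> I -> R) :
    \sum_(A : {set I} | #|A| == m) \sum_(a in A) \sum_(b in ~: A) F A a b
    = \sum_(t | P t) F t.1.1 t.1.2 t.2.
  under eq_bigr => A _ do rewrite pair_big_dep /=.
  rewrite pair_big_dep /= (reindex (fun t : T => (t.1.1, (t.1.2, t.2)))) //.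
  by exists (fun u => (u.1, u.2.1, u.2.2)) => [[[]]|[? []]].
have swapK t : P t -> swap (swap t) = t.
  case: t => [[A a] b] /and3P[/= _ aA]; rewrite inE => bA.
  rewrite /swap /=; congr (_, _, _); apply/setP => x; rewrite !inE.
  have [->|xa] := eqVneq x a; rewrite ?aA //=.
  by have [->|xb] := eqVneq x b; rewrite ?(negbTE bA).
have swapP t : P t -> P (swap t).
  case: t => [[A a] b] /and3P[/= /eqP cA aA]; rewrite inE => bA.
  have ab : a != b by apply: contraNneq bA => <-.
  rewrite /P /swap /= !inE !eqxx (negbTE ab) /= andbT.
  by rewrite cardsU1 !inE (negbTE bA) andbF /= -cA (cardsD1 a A) aA.
have swapS t : P t -> subsum (swap t).1.1 = subsum t.1.1 - (X t.1.2 - X t.2).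
  case: t => [[A a] b] /and3P[/= _ aA]; rewrite inE => bA.
  rewrite /subsum big_setU1 ?inE ?(negbTE bA) ?andbF //= (big_setD1 a aA) /=.
  by rewrite opprB [RHS]addrC [RHS]addrA subrK.
have reswap (F : T -> R) : \sum_(t | P t) F t = \sum_(t | P t) F (swap t).
  rewrite (reindex_onto swap swap) //=; apply: eq_bigl => t.
  apply/andP/idP => [[Ps /eqP ss]|Pt]; last by rewrite swapP // swapK.
  by rewrite -ss swapP.
have lhs : #|I|%:R * moment m q.+1
    = \sum_(t | P t) \tr ((X t.1.2 - X t.2) * subsum t.1.1 ^+ q.*2.+1).
  rewrite -(triple (fun A a b => \tr ((X a - X b) * subsum A ^+ q.*2.+1))).
  rewrite /moment mulr_sumr; apply: eq_bigr => A _.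
  rewrite doubleS exprS mulr_natl -raddfMn -mulrnAl -sum_exchange.
  rewrite mulr_suml raddf_sum; apply: eq_bigr => a _ /=.
  by rewrite mulr_suml raddf_sum.
pose Q t := \tr ((X t.1.2 - X t.2) * (X t.1.2 - X t.2) * subsum t.1.1 ^+ q.*2).
have rhs : \sum_(t | P t) Q t
    <= 2 * (m * (#|I| - m))%:R * moment m q + 2 * moment m q.+1.
  rewrite /Q -(triple (fun A a b => \tr ((X a - X b) * (X a - X b) * subsum A ^+ q.*2))).
  rewrite /moment !mulr_sumr -big_split; apply: ler_sum => A /eqP cA /=.
  have cCA : #|~: A| = (#|I| - m)%N by rewrite cardsCs finset.setCK cA.
  by have := exchange_trace_le A q; rewrite cCA cA.
have QS t : P t -> Q (swap t) = \tr ((X t.1.2 - X t.2) * (X t.1.2 - X t.2) * subsum (swap t).1.1 ^+ q.*2).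
  by move=> _; rewrite /Q /= -(mulrNN (X t.2 - _)) !opprB.
(* Adding the sum to its image under [swap] turns the power of S_A into a difference of powers, the
   form that [trace_mean_value] bounds. *)
have dbl : 2 * (#|I|%:R * moment m q.+1) = \sum_(t | P t)
   \tr ((X t.1.2 - X t.2) * (subsum t.1.1 ^+ q.*2.+1 - subsum (swap t).1.1 ^+ q.*2.+1)).
  rewrite mulr_natl mulr2n lhs {2}reswap -big_split; apply: eq_bigr => t _ /=.
  by rewrite mulrBr raddfB /=; congr (_ + _); rewrite -raddfN -mulNr opprB.
have : 2 * (2 * (#|I|%:R * moment m q.+1)) <= q.*2.+1%:R * (2 * \sum_(t | P t) Q t).
  have -> : 2 * \sum_(t | P t) Q t = \sum_(t | P t) (Q t + Q (swap t)).
    by rewrite big_split /= -reswap mulr_natl.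
  rewrite dbl !mulr_sumr; apply: ler_sum => t Pt.
  rewrite QS // /Q -raddfD -mulrDr.
  have -> : X t.1.2 - X t.2 = subsum t.1.1 - subsum (swap t).1.1.
    by rewrite swapS // subKr.
  by apply: trace_mean_value; exact: subsum_sym.
move=> le1; have := ler_wpM2l (ler0n R q.*2.+1) rhs; lra.
Qed.

(** The moment of order q+1 on the right of [moment_exchange] is absorbed on the left: as 2q+1 <= m,
    the remaining coefficient is at least |I| - m, which cancels against the same factor on the
    right. *)
Lemma moment_step m q : (m <= #|I|)%N -> (q.*2 < m)%N ->
  moment m q.+1 <= (q.*2.+1 * m)%:R * moment m q.
Proof.
move=> mn qm.
have M0 r : 0 <= moment m r.
  apply: sumr_ge0 => A _; have := frob_ge0 (subsum A ^+ r).
  by rewrite frobE trmxX subsum_sym mulmxE -exprD addnn.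
(* For m = |I| nothing can be cancelled, but the only subset is the full one and its sum
   vanishes. *)
have [lt|ge] := ltnP m #|I|; last first.
  rewrite (_ : moment m q.+1 = 0) ?mulr_ge0 ?ler0n //.
  rewrite /moment big1 // => A /eqP cA.
  have -> : subsum A = 0.
    have -> : A = [set: I] by apply/eqP; rewrite eqEcard finset.subsetT cardsT cA.
    by rewrite /subsum -[RHS]sumX; apply: eq_bigl => a; rewrite inE.
  by rewrite doubleS expr0n raddf0.
have := moment_exchange q mn.
rewrite !natrM natrB // => ex.
have nm : 0 < #|I|%:R - m%:R :> R by rewrite subr_gt0 ltr_nat.
rewrite -(ler_pM2l nm).
have : q.*2.+1%:R <= m%:R :> R by rewrite ler_nat.
move=> /(ler_wpM2r (M0 q.+1)); lra.
Qed.

(** Iterates [moment_step] from the zeroth moment, where each subset contributes the trace d of the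
    identity. The odd factors build (2q-1)!!, as for a Gaussian of variance m. *)
Lemma moment_le m q : (m <= #|I|)%N -> (q.*2 <= m)%N ->
  moment m q <= ('C(#|I|, m) * d)%:R * (\prod_(i < q) (i.*2.+1)%:R) * m%:R ^+ q.
Proof.
move=> mn; elim: q => [|q IH] qm.
  rewrite big_ord0 expr0 !mulr1 /moment.
  under eq_bigr => A _ do rewrite expr0 mxtrace1.
  by rewrite sumr_const -cardsE card_draws -mulrnA mulnC.
apply: le_trans (moment_step mn _) _; first by lia.
rewrite big_ord_recr /= exprS natrM.
have := IH ltac:(lia) => /(ler_wpM2l (ler0n R (q.*2.+1 * m))).
rewrite natrM; set p := \prod_(i < q) _; lra.
Qed.
End Moments.

(** * Quadratic forms and traces of even powers *)

Section Quad.
Variable R : realFieldType.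

Lemma frob_comb d e (s t : R) (A B : 'M[R]_(d, e)) :
  frob (s *: A + t *: B) (s *: A + t *: B)
  = s ^+ 2 * frob A A + 2 * s * t * frob A B + t ^+ 2 * frob B B.
Proof.
rewrite /frob !mulr_sumr -!big_split; apply: eq_bigr => i _.
rewrite !mulr_sumr -!big_split; apply: eq_bigr => j _ /=.
by rewrite !mxE; ring.
Qed.

Lemma frob_CS d e (A B : 'M[R]_(d, e)) : frob A B ^+ 2 <= frob A A * frob B B.
Proof.
have a0 := frob_ge0 A; have b0 := frob_ge0 B.
have [bp|bn] := ltP 0 (frob B B).
  rewrite -(ler_pM2l bp) -subr_ge0.
  have := frob_ge0 (frob B B *: A + (- frob A B) *: B); rewrite frob_comb.
  by set x := _ + _; set y := _ - _; suff -> : x = y by []; rewrite /x /y; ring.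
have {b0 bn} b0 : frob B B = 0 by apply/eqP; rewrite eq_le bn b0.
rewrite b0 mulr0; case: (eqVneq (frob A B) 0) => [->|nz]; first by rewrite expr0n.
(* With c = <A, B>, a = |A|^2 and |B| = 0, this norm equals c^2 a - 2 c^2 (a + 1), which is negative
   unless c = 0. *)
have := frob_ge0 (frob A B *: A + (- (frob A A + 1)) *: B).
rewrite frob_comb b0 => ge.
have : 0 < frob A B ^+ 2 by rewrite exprn_even_gt0.
have := mulr_ge0 a0 (sqr_ge0 (frob A B)); nra.
Qed.

(** Cauchy-Schwarz applied to each row of [A]. *)
Lemma frob_mul_col d e (A : 'M[R]_(d, e)) (w : 'cV[R]_e) :
  frob (A *m w) (A *m w) <= frob A A * frob w w.
Proof.
have -> : frob w w = frob w^T w^T.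
  by rewrite /frob exchange_big; apply: eq_bigr => i _; apply: eq_bigr => j _; rewrite !mxE.
rewrite {1 2}/frob mulr_suml; apply: ler_sum => i _.
have := frob_CS (row i A) w^T.
have -> : frob (row i A) w^T = (A *m w) i 0.
  by rewrite /frob big_ord1 mxE; apply: eq_bigr => j _; rewrite !mxE.
have -> : frob (row i A) (row i A) = \sum_j A i j * A i j.
  by rewrite /frob big_ord1; apply: eq_bigr => j _; rewrite !mxE.
by rewrite big_ord1 expr2.
Qed.

(* The ratios of the consecutive moments e j = |S^j w|^2 are nondecreasing. *)
Lemma quad_trace d (S : 'M[R]_d) (w : 'cV[R]_d) (th : R) q : S^T = S -> 0 <= th ->
  th * frob w w < frob w (S *m w) -> th ^+ q.*2 <= \tr (S ^+ q.*2).
Proof.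
move=> symS th0 lt.
pose e j := frob (S ^+ j *m w) (S ^+ j *m w).
have frobX a b : frob (S ^+ a *m w) (S ^+ b *m w) = \tr (w^T *m (S ^+ (a + b) *m w)).
  by rewrite frobE trmx_mul trmxX symS exprD -mulmxE !mulmxA.
have e_ge0 j : 0 <= e j by exact: frob_ge0.
have e0 : e 0%N = frob w w by rewrite /e expr0 mul1mx.
have e_pos : 0 < e 0%N.
  rewrite lt_def e_ge0 andbT; apply: contraTneq lt => z.
  have := frob_CS w (S *m w); rewrite -e0 z mul0r mulr0 => sq.
  have : frob w (S *m w) == 0 by rewrite -sqrf_eq0 eq_le sq sqr_ge0.
  by move=> /eqP ->; rewrite ltxx.
(* The case j = 0 is Cauchy-Schwarz for w and S w; the induction uses the log-convexity e_(j+1)^2 <=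
   e_j e_(j+2). *)
have grow j : th ^+ 2 * e j <= e j.+1.
  elim: j => [|j IH].
    have := frob_CS w (S *m w).
    have -> : frob (S *m w) (S *m w) = e 1%N by rewrite /e expr1.
    rewrite -e0 => cs; rewrite -(ler_pM2l e_pos); apply: le_trans cs.
    rewrite [leLHS](_ : _ = (th * e 0%N) ^+ 2); last by ring.
    have le0 : 0 <= th * e 0%N by rewrite mulr_ge0.
    rewrite e0 in le0 *; apply: lerXn2r; rewrite ?nnegrE //; last exact: ltW.
    exact: le_trans le0 (ltW lt).
  have := frob_CS (S ^+ j *m w) (S ^+ j.+2 *m w).
  have -> : frob (S ^+ j *m w) (S ^+ j.+2 *m w) = e j.+1.
    by rewrite /e !frobX; congr (\tr (_ *m (_ ^+ _ *m _))); lia.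
  rewrite -/(e j) -/(e j.+2) => cs.
  have [p|n] := ltP 0 (e j.+1); last first.
    by rewrite (_ : e j.+1 = 0) ?mulr0 //; apply/eqP; rewrite eq_le n e_ge0.
  rewrite -(ler_pM2l p).
  have := ler_wpM2r (e_ge0 j.+2) IH; have := ler_wpM2l (sqr_ge0 th) cs.
  lra.
have : th ^+ q.*2 * e 0%N <= e q.
  elim: q => [|q IH]; first by rewrite mul1r.
  apply: le_trans (grow q); rewrite (_ : th ^+ q.+1.*2 = th ^+ 2 * th ^+ q.*2); last by rewrite doubleS -exprD.
  by rewrite -mulrA ler_wpM2l // sqr_ge0.
(* The squared Frobenius norm of S^q is the trace of S^(2q), and it dominates e_q / e_0. *)
have := frob_mul_col (S ^+ q) w; rewrite -/(e q) -e0.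
rewrite frobE trmxX symS mulmxE -exprD addnn => h1 h2.
by rewrite -(ler_pM2r e_pos); apply: le_trans h2 h1.
Qed.
End Quad.

(** * Estimates for the tail *)

Section Numeric.
Variable R : realType.

(** From 1 + x <= e^x at x = -1/7, together with (6/7)^7 > 1/3. *)
Lemma expR1_lt3 : expR 1 < 3 :> R.
Proof.
have h : (6 / 7 : R) ^+ 7 <= expR (- 1).
  have := expR_ge1Dx (- (1 / 7) : R); rewrite (_ : 1 + - (1/7) = 6 / 7 :> R); last by field.
  move=> /(lerXn2r 7); rewrite !nnegrE => /(_ ltac:(lra) (expR_ge0 _)).
  by rewrite -expRM_natl (_ : 7 * - (1/7) = -1 :> R) //; field.
have e : expR 1 * expR (-1) = 1 :> R by exact: expRxMexpNx_1.
have p := expR_gt0 (1 : R).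
nra.
Qed.

(** A weak Stirling bound; the induction step is (M/(M+1))^(M+1) <= 1/e, an instance of 1 + x <=
    e^x. *)
Lemma fact_le_expR (N : nat) : (0 < N)%N ->
  N`!%:R <= N%:R ^+ N.+1 * expR (1 - N%:R) :> R.
Proof.
elim: N => // [[|N] IH] _; first by rewrite subrr expR0 expr1n mulr1.
set M := N.+1 in IH *.
have M0 : 0 < M%:R :> R by rewrite ltr0n.
rewrite factS natrM exprS -mulrA ler_pM2l ?ltr0n //.
apply: le_trans (IH isT) _.
have -> : 1 - M.+1%:R = 1 - M%:R - 1 :> R by rewrite -natr1; ring.
rewrite (expRD (1 - M%:R)) mulrA [leRHS]mulrAC ler_pM2r ?expR_gt0 //.
have h : M%:R / M.+1%:R <= expR (- M.+1%:R^-1) :> R.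
  apply: le_trans (expR_ge1Dx _); rewrite le_eqVlt; apply/orP; left; apply/eqP.
  by rewrite -natr1; field; rewrite natr1 pnatr_eq0.
have := lerXn2r M.+1 _ _ h; rewrite !nnegrE => /(_ ltac:(by rewrite divr_ge0 ?ler0n) (expR_ge0 _)).
rewrite -expRM_natl mulrN divff ?pnatr_eq0 // expr_div_n ler_pdivrMr ?exprn_gt0 ?ltr0n //.
by rewrite mulrC.
Qed.

Lemma dfact_sqr_le q : ((\prod_(i < q) i.*2.+1) ^ 2 <= (q.*2)`!)%N.
Proof.
elim: q => [|q IH]; first by rewrite big_ord0.
rewrite big_ord_recr /= expnMn doubleS !factS mulnC.
have : (q.*2.+1 ^ 2 <= q.*2.+2 * q.*2.+1)%N by rewrite expnS expn1 leq_mul2r orbC leqnSn.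
by rewrite mulnA => h; exact: leq_mul.
Qed.

(** The square of (2q-1)!! is at most (2q)!. As t - 2 < 2q <= t, the Stirling bound turns the
    squared claim into n^4 t e^(3-t) < 9. *)
Lemma tail_small (n t : R) (q : nat) : 10 ^+ 6 < n -> 9 / 2 * ln n <= t ->
  q = Num.truncn (t / 2) ->
  2 * n * (\prod_(i < q) (i.*2.+1)%:R) < 6 / n * t ^+ q.
Proof.
move=> n6 tn qE.
have n0 : 0 < n by apply: lt_trans n6; rewrite exprn_gt0.
set L := ln n in tn; have nE : n = expR L by rewrite lnK // posrE.
(* Because e < 3 and 3^12 < 10^6. *)
have L12 : 12 < L.
  rewrite -ltr_expR -nE; apply: lt_trans n6.
  rewrite -[12]mulr1 expRM_natl.
  apply: (@lt_trans _ _ (3 ^+ 12)); last by lra.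
  by rewrite ltrXn2r // ?nnegrE ?expR_ge0 // expR1_lt3.
have t54 : 54 < t by lra.
have qle : q%:R * 2 <= t by rewrite -ler_pdivlMr // qE truncn_le; lra.
have qgt : t / 2 < q%:R + 1 by rewrite natr1 qE truncnS_gt.
have q0 : (0 < q)%N by rewrite -(ltr_nat R); lra.
set P := \prod_(i < q) _.
have P0 : 0 <= P by apply: prodr_ge0 => i _; exact: ler0n.
have t0 : 0 < t by lra.
have P2 : P ^+ 2 <= t ^+ q.*2 * (t * expR (3 - t)).
  have -> : P = (\prod_(i < q) i.*2.+1)%:R by rewrite natr_prod.
  rewrite -natrX; apply: (@le_trans _ _ (q.*2)`!%:R).
    by rewrite ler_nat dfact_sqr_le.
  apply: le_trans (fact_le_expR _) _; first by lia.
  have dq : q.*2%:R <= t by rewrite -muln2 natrM.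
  rewrite exprS [leRHS]mulrCA -[leLHS]mulrA; apply: ler_pM => //.
  - by rewrite mulr_ge0 ?exprn_ge0 ?expR_ge0.
  - apply: ler_pM; rewrite ?exprn_ge0 ?expR_ge0 //.
      by apply: lerXn2r; rewrite ?nnegrE // ltW.
    rewrite ler_expR; move: qgt; rewrite -muln2 natrM; lra.
(* Since ln n <= 2t/9, with s = t/9 it is enough that s < e^(s-3). For s > 6 this follows from
   e^(s-3) >= ((s-1)/2)^2. *)
have big : n ^+ 4 * (t * expR (3 - t)) < 9.
  have le : n ^+ 4 <= expR (8 * (t / 9)).
    by rewrite nE -expRM_natl ler_expR; lra.
  pose s := t / 9; have s6 : 6 < s by rewrite /s; lra.
  have slt : s < expR (s - 3).
    have := expR_ge1Dx ((s - 3) / 2); set y := expR _ => yge.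
    have -> : expR (s - 3) = y ^+ 2.
      by rewrite -expRM_natl; congr expR; field.
    nra.
  have pe : 0 <= t * expR (3 - t) by rewrite mulr_ge0 ?expR_ge0 ?ltW.
  apply: le_lt_trans (ler_wpM2r pe le) _.
  rewrite mulrCA -expRD -/s (_ : 8 * s + (3 - t) = - (s - 3)); last by rewrite /s; field.
  rewrite expRN (_ : t = 9 * s); last by rewrite /s; field.
  by rewrite -mulrA gtr_pMr // ltr_pdivrMr ?expR_gt0 // mul1r.
have T0 : 0 < t ^+ q by rewrite exprn_gt0.
rewrite [ltRHS]mulrAC ltr_pdivlMr //.
suff : n ^+ 2 * P < 3 * t ^+ q by lra.
rewrite -(@ltr_pXn2r _ 2) ?nnegrE ?mulr_ge0 ?exprn_ge0 ?(ltW n0) ?(ltW t0) //.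
rewrite [in ltLHS]exprMn -exprM [in ltRHS]exprMn -[in ltRHS]exprM.
apply: (@le_lt_trans _ _ (n ^+ 4 * (t ^+ q.*2 * (t * expR (3 - t))))).
  by rewrite ler_wpM2l ?exprn_ge0 ?(ltW n0).
rewrite mulrCA muln2 mulrC ltr_pM2r ?exprn_gt0 //; lra.
Qed.
End Numeric.

(** * Faces of the join *)

(** Reindexes a sum whose terms vanish off the image of [h]; it serves to enumerate the faces
    incident to a given one, all other incidence coefficients being 0. *)
Lemma big_supp (R : nmodType) (T U : finType) (h : U -> T) (Q : pred U) (P : pred T)
    (F : T -> R) :
  {in Q &, injective h} -> (forall u, Q u -> P (h u)) ->
  (forall t, P t -> F t != 0 -> exists2 u, Q u & t = h u) ->
  \sum_(t | P t) F t = \sum_(u | Q u) F (h u).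
Proof.
move=> inj QP sup; rewrite -(big_imset F inj) /= (bigID (mem (h @: Q))) /=.
rewrite [X in _ + X]big1 ?addr0; last first.
  move=> t /andP[Pt nt]; apply/eqP; apply: contraNT nt => /(sup t Pt)[u Qu ->].
  exact: imset_f.
apply: eq_bigl => t; apply/andP/idP => [[]//|ti]; split=> //.
by case/imsetP: ti => u Qu ->; exact: QP.
Qed.

Section Pairs.
Variables (R : nmodType) (K : nat).

Lemma sum_offdiag (f : 'I_K -> 'I_K -> R) :
  \sum_i \sum_(j | j != i) f i j = \sum_(i < K) \sum_(j < K | (i < j)%N) (f i j + f j i).
Proof.
under [RHS]eq_bigr => i _ do rewrite big_split /=.
rewrite big_split /= [X in _ + X](exchange_big_dep xpredT) //= -big_split; apply: eq_bigr => i _ /=.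
rewrite (bigID (fun j : 'I_K => (i < j)%N)) /=; congr (_ + _); apply: eq_bigl => j.
  by rewrite -val_eqE /=; lia.
by rewrite -val_eqE /=; lia.
Qed.

Lemma sum_card1 (f : {set 'I_K} -> R) :
  \sum_(J : {set 'I_K} | #|J| == 1%N) f J = \sum_i f [set i].
Proof.
apply: (big_supp (h := fun i => [set i])) => [i j _ _ /set1_inj //|i _|J /cards1P[i ->] _].
  by rewrite cards1.
by exists i.
Qed.

Lemma sum_card2 (f : {set 'I_K} -> R) :
  \sum_(J : {set 'I_K} | #|J| == 2%N) f J
  = \sum_(i < K) \sum_(j < K | (i < j)%N) f [set i; j].
Proof.
rewrite pair_big_dep /=.
apply: (big_supp (h := fun u : 'I_K * 'I_K => [set u.1; u.2])) => [[i j] [i' j']|[i j]|J].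
- rewrite !unfold_in /= => ij ij' E; apply/eqP.
  have := set21 i j; have := set22 i j; rewrite E !inE => /orP[]/eqP ej /orP[]/eqP ei;
    move: ij ij'; rewrite ei ej ?eqxx //; lia.
- by move=> /= ij; rewrite cards2 -val_eqE neq_ltn /= ij.
- case/cards2P => [i [j [ij ->]]] _.
  move: ij; rewrite -val_eqE neq_ltn /= => /orP[] ij; first by exists (i, j).
  by exists (j, i) => //=; rewrite finset.setUC.
Qed.
End Pairs.

Section Faces.
Variables (k : nat) (gT : finGroupType).
Implicit Types (x y : {ffun 'I_k.+1 -> gT}) (J L : {set 'I_k.+1}) (S : {set vtx k gT}).

(* The face of the facet {(i, x_i)} obtained by dropping the colours in J. *)
Definition face x J : {set vtx k gT} := [set v | (v.1 \notin J) && (v.2 == x v.1)].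
Definition upd x (i : 'I_k.+1) (g : gT) : {ffun 'I_k.+1 -> gT} :=
  [ffun l => if l == i then g else x l].

Lemma face_colorful x J : colorful (face x J).
Proof.
apply/forall_inP => -[i g] /[!inE] /andP[/= iJ /eqP ->].
apply/forall_inP => -[j h] /[!inE] /andP[/= jJ /eqP ->].
by apply/implyP => /= /eqP ->.
Qed.

Lemma face_imset x J : face x J = [set (i, x i) | i in ~: J].
Proof.
apply/setP => -[i g]; rewrite !inE /=; apply/andP/imsetP => [[iJ /eqP ->]|[l /[!inE] lJ [-> ->]]].
  by exists i; rewrite ?inE.
by rewrite lJ eqxx.
Qed.

Lemma card_face x J : #|face x J| = #|~: J|.
Proof. by rewrite face_imset card_imset // => i j []. Qed.

Lemma face_eqP x y J L :
  reflect (J = L /\ forall i, i \notin J -> x i = y i) (face x J == face y L).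
Proof.
apply: (iffP eqP) => [E|[<- xy]]; last first.
  by apply/setP => -[i g]; rewrite !inE /=; case: (boolP (i \in J)) => //= /xy ->.
have sub z t M N : face z M = face t N -> M \subset N.
  move=> e; apply/fintype.subsetP => i; apply: contraTT => iN.
  have : (i, t i) \in face t N by rewrite inE /= iN eqxx.
  by rewrite -e inE /= => /andP[].
have JL : J = L by apply/eqP; rewrite finset.eqEsubset (sub _ _ _ _ E) (sub _ _ _ _ (esym E)).
split=> // i iJ; have : (i, x i) \in face x J by rewrite inE /= iJ eqxx.
by rewrite E inE /= => /andP[_ /eqP].
Qed.

Lemma colorful_face S : colorful S -> exists x J, S = face x J.
Proof.
(* On the colours that S misses, [eltc] takes its default value 1; exactly these colours are put
   into J. *)
move=> colS; exists [ffun i => eltc S i], [set i | [forall g, (i, g) \notin S]].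
have eltS i g : (i, g) \in S -> eltc S i = g.
  move=> igS; rewrite /eltc; case: pickP => [h ihS|/(_ g)]; last by rewrite igS.
  have /forall_inP/(_ _ ihS)/forall_inP/(_ _ igS) := colS.
  by rewrite /= eqxx /= => /eqP[].
apply/setP => -[i g]; rewrite !inE ffunE /=; apply/idP/andP => [igS|[]].
  by rewrite (eltS i g igS); split=> //; apply/negP => /forallP/(_ g); rewrite igS.
by rewrite negb_forall => /existsP[h]; rewrite negbK => ihS /eqP ->; rewrite (eltS i h ihS).
Qed.

Lemma prodS_face x : prodS (face x finset.set0) = (\prod_(i < k.+1) x i)%g.
Proof.
apply: eq_bigr => i _; rewrite /eltc; case: pickP => [g|/(_ (x i))].
  by rewrite !inE /= => /eqP.
by rewrite !inE /= eqxx.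
Qed.

Lemma card_agree x J : #|[set y : {ffun 'I_k.+1 -> gT} | [forall i, (i \notin J) ==> (x i == y i)]]| = (#|gT| ^ #|J|)%N.
Proof.
rewrite cardsE.
pose F (i : 'I_k.+1) : pred gT := fun g => (i \notin J) ==> (x i == g).
rewrite (eq_card (B := family F)); last first.
  by move=> y; rewrite !unfold_in /=.
rewrite card_family foldrE big_map big_enum /=.
rewrite -prod_nat_const [RHS]big_mkcond /=; apply: eq_bigr => i _.
case: ifP => iJ; first by apply: eq_card => g; rewrite -!topredE /= /F iJ.
rewrite -(card1 (x i)); apply: eq_card => g; rewrite -!topredE /= /F iJ /= eq_sym.
by [].
Qed.

(** A face with p vertices determines J, and its coordinates outside J; the k+1-p coordinates in J
    are free, so it arises from |G|^(k+1-p) facets. *)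
Lemma sum_faces (R : pzRingType) (p : nat) (F : {set vtx k gT} -> R) : (p <= k.+1)%N ->
  (\sum_(S : {set vtx k gT} | colorful S && (#|S| == p)) F S) * #|gT|%:R ^+ (k.+1 - p)
  = \sum_(J : {set 'I_k.+1} | #|J| == (k.+1 - p)%N) \sum_x F (face x J).
Proof.
move=> pk; rewrite pair_big_dep /=.
have cardC J : (#|J| == (k.+1 - p)%N) = (#|~: J| == p).
  by have := cardsC J; rewrite card_ord; lia.
rewrite (partition_big (fun u : {set 'I_k.+1} * {ffun 'I_k.+1 -> gT} => face u.2 u.1)
   (fun S => colorful S && (#|S| == p))) /=; last first.
  by move=> [J x] /=; rewrite andbT cardC card_face face_colorful.
rewrite mulr_suml; apply: eq_bigr => S /andP[/colorful_face[x [J ->]]].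
rewrite card_face -cardC => /eqP cJ.
rewrite (eq_bigr (fun=> F (face x J))); last by move=> u /andP[_ /eqP ->].
rewrite sumr_const -natrX mulr_natr; congr (_ *+ _).
rewrite -cJ -(card_agree x J).
have injJ : injective (fun y : {ffun 'I_k.+1 -> gT} => (J, y)) by move=> ? ? [].
rewrite -(card_imset _ injJ).
apply/esym/eq_card => -[L y]; apply/idP/imsetP; rewrite unfold_in /= andbT.
  case/andP => _; rewrite eq_sym => /face_eqP[<- xy]; exists y => //.
  by rewrite inE; apply/forall_inP => i /xy ->.
case=> z /[!inE] /forall_inP xz [-> ->].
rewrite cJ eqxx eq_sym; apply/face_eqP; split=> // i iJ.
exact/eqP/xz.
Qed.

(** Exchanging g with the i-th coordinate of x is an involution on pairs, after which g is free. *)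
Lemma sum_upd (R : pzRingType) (F : {ffun 'I_k.+1 -> gT} -> R) i :
  \sum_x \sum_g F (upd x i g) = #|gT|%:R * \sum_x F x.
Proof.
rewrite pair_big /=.
pose s (u : {ffun 'I_k.+1 -> gT} * gT) := (upd u.1 i u.2, u.1 i).
have sK : involutive s.
  move=> [x g]; rewrite /s /= ffunE eqxx; congr (_, _).
  by apply/ffunP => l; rewrite !ffunE; case: eqP => [->|].
rewrite -(reindex_inj (inv_inj sK) (P := xpredT) (F := fun u => F u.1)) /=.
rewrite -(pair_big xpredT xpredT (fun x (g : gT) => F x)) /=.
by rewrite mulr_sumr; apply: eq_bigr => x _; rewrite sumr_const mulr_natl.
Qed.

(** Freezing all coordinates but two leaves a two-variable kernel; the order i < j fixes which
    variable comes first in the possibly noncommutative product. *)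
Lemma prod_upd2 x (i j : 'I_k.+1) : (i < j)%N ->
  exists a b c, forall g h, (\prod_l upd (upd x i g) j h l = a * g * b * h * c)%g.
Proof.
move=> ij; pose y l := x (inord l).
exists (\prod_(0 <= l < i) y l)%g, (\prod_(i.+1 <= l < j) y l)%g, (\prod_(j.+1 <= l < k.+1) y l)%g.
move=> g h; pose f l := upd (upd x i g) j h (inord l).
transitivity (\prod_(0 <= l < k.+1) f l)%g.
  by rewrite big_mkord; apply: eq_bigr => l _; rewrite /f inord_val.
have iK := ltn_ord i; have jK := ltn_ord j.
have fE l : (l < k.+1)%N -> l != i -> l != j -> f l = y l.
  by move=> lK li lj; rewrite /f !ffunE -!val_eqE /= inordK // (negbTE li) (negbTE lj).
have fi : f i = g.
  by rewrite /f inord_val !ffunE -val_eqE /= (ltn_eqF ij) eqxx.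
have fj : f j = h by rewrite /f inord_val !ffunE eqxx.
rewrite (big_cat_nat (n := i)) //=; last exact: ltnW.
rewrite (big_ltn iK) (big_cat_nat (m := i.+1) (n := j)) //=; last exact: (ltnW jK).
rewrite (big_ltn jK) fi fj !mulgA.
by congr (_ * _ * _ * _ * _)%g; apply: eq_big_nat => l /andP[l1 l2]; apply: fE;
  rewrite ?neq_ltn; lia.
Qed.

Lemma prod_upd1 x (i : 'I_k.+1) :
  exists a c, forall g, (\prod_l upd x i g l = a * g * c)%g.
Proof.
pose y l := x (inord l).
exists (\prod_(0 <= l < i) y l)%g, (\prod_(i.+1 <= l < k.+1) y l)%g.
move=> g; pose f l := upd x i g (inord l).
transitivity (\prod_(0 <= l < k.+1) f l)%g.
  by rewrite big_mkord; apply: eq_bigr => l _; rewrite /f inord_val.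
have iK := ltn_ord i.
have fE l : (l < k.+1)%N -> l != i -> f l = y l.
  by move=> lK li; rewrite /f !ffunE -!val_eqE /= inordK // (negbTE li).
have fi : f i = g by rewrite /f inord_val !ffunE eqxx.
rewrite (big_cat_nat (n := i)) //=; last exact: ltnW.
rewrite (big_ltn iK) fi !mulgA.
by congr (_ * _ * _)%g; apply: eq_big_nat => l /andP[l1 l2]; apply: fE;
  rewrite ?neq_ltn; lia.
Qed.

Lemma updC x (i j : 'I_k.+1) g h : i != j -> upd (upd x i g) j h = upd (upd x j h) i g.
Proof.
move=> ij; apply/ffunP => l; rewrite !ffunE.
by have [->|//] := eqVneq l j; rewrite eq_sym (negbTE ij).
Qed.

Lemma sum_translate (R : nmodType) (f : gT -> R) a c : \sum_g f (a * g * c)%g = \sum_g f g.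
Proof. by rewrite [RHS](reindex_inj (inj_comp (mulIg c) (mulgI a))). Qed.
End Faces.

(** * The Laplacian *)

Section Energy.
Variables (R : realType) (V : finType) (col : V -> nat) (F : nat -> {set {set V}}).

Lemma inc_add (v : V) (s : {set V}) : v \notin s ->
  inc R col (v |: s) s = (-1) ^+ #|[set w in v |: s | (col w < col v)%N]|.
Proof.
move=> vs; rewrite /inc finset.subsetUr cardsU1 vs eqxx /=; case: pickP => [w|/(_ v)].
  rewrite !inE => /andP[ws]; rewrite (negbTE ws) orbF => /eqP -> //.
by rewrite !inE vs eqxx.
Qed.

Lemma inc_neq0 (t s : {set V}) : inc R col t s != 0 -> exists2 v, v \notin s & t = v |: s.
Proof.
rewrite /inc; case: ifP => [/andP[st /eqP ct]|]; last by rewrite eqxx.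
case: pickP => [v|]; last by rewrite eqxx.
rewrite inE => /andP[vs vt] _; exists v => //.
apply/eqP; rewrite eq_sym eqEcard cardsU1 vs ct leqnn andbT.
by apply/fintype.subsetP => w /[!inE] /orP[/eqP -> //|]; move/fintype.subsetP: st; exact.
Qed.

(** Summation by parts: [cob] and [cobadj] share the same incidence matrix, hence are adjoint on
    cochains. *)
Lemma energy (p : nat) (phi : {set V} -> R) :
  \sum_(S in F p.+1) phi S * lap col F p.+1 phi S
  = \sum_(r in F p) cobadj col F p phi r ^+ 2 + \sum_(t in F p.+2) cob col F p.+1 phi t ^+ 2.
Proof.
rewrite /lap /=; under eq_bigr => S _ do rewrite mulrDr.
rewrite big_split /=; congr (_ + _).
  under [RHS]eq_bigr => r rF do rewrite expr2 {2}/cobadj rF mulr_sumr.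
  rewrite exchange_big /=; apply: eq_bigr => S SF.
  by rewrite /cob SF mulr_sumr; apply: eq_bigr => r _; ring.
under [RHS]eq_bigr => r rF do rewrite expr2 {2}/cob rF mulr_sumr.
rewrite exchange_big /=; apply: eq_bigr => S SF.
by rewrite {1}/cobadj SF mulr_sumr; apply: eq_bigr => r _; ring.
Qed.

(** Matrix entries of the Laplacian; they are visibly symmetric in S and T, which gives real
    eigenvectors. *)
Definition lapK (p : nat) (S T : {set V}) : R :=
  \sum_(r in F p) inc R col S r * inc R col T r + \sum_(t in F p.+2) inc R col t S * inc R col t T.

Lemma lap_kernel (p : nat) (phi : {set V} -> R) (S : {set V}) : S \in F p.+1 ->
  lap col F p.+1 phi S = \sum_(T in F p.+1) lapK p S T * phi T.
Proof.
move=> SF; rewrite /lap /= /lapK; under [RHS]eq_bigr => T _ do rewrite mulrDl.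
rewrite big_split /= [cob _ _ _ _ S]/cob SF [cobadj _ _ _ _ S]/cobadj SF; congr (_ + _).
  under [RHS]eq_bigr => T _ do rewrite mulr_suml.
  rewrite exchange_big /=; apply: eq_bigr => r rF.
  by rewrite /cobadj rF mulr_sumr; apply: eq_bigr => T _; ring.
under [RHS]eq_bigr => T _ do rewrite mulr_suml.
rewrite exchange_big /=; apply: eq_bigr => t tF.
by rewrite /cob tF mulr_sumr; apply: eq_bigr => T _; ring.
Qed.
End Energy.

Section Complex.
Variables (R : realType) (k : nat) (gT : finGroupType) (A : {set gT}).
Implicit Types (x : {ffun 'I_k.+1 -> gT}) (J : {set 'I_k.+1}) (i j : 'I_k.+1).
Let col (v : vtx k gT) : nat := nat_of_ord v.1.
Let F := @faceY k gT A.
Let n : R := #|gT|%:R.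
Variable phi : {set vtx k gT} -> R.

Lemma faceU1 x J i : i \notin J -> face x J = (i, x i) |: face x (i |: J).
Proof.
move=> iJ; apply/setP => -[l g]; rewrite !inE /= xpair_eqE.
by have [->|_] := eqVneq l i; rewrite ?(negbTE iJ) ?eqxx /= ?andbF ?orbF.
Qed.

Lemma inc_face x J i : i \notin J ->
  inc R col (face x J) (face x (i |: J)) = (-1) ^+ #|[set l | (l \notin J) && (l < i)%N]|.
Proof.
move=> iJ; rewrite {1}(faceU1 x iJ) inc_add ?inE /= ?eqxx // -faceU1 //; congr (_ ^+ _).
rewrite -(card_imset _ (_ : injective (fun l => (l, x l)))); last by move=> ? ? [].
apply: eq_card => -[l g]; rewrite !inE /col /=; apply/andP/imsetP.
  by case=> /andP[lJ /eqP ->] li; exists l; rewrite // inE lJ.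
by case=> m; rewrite inE => /andP[mJ mi] [-> ->]; rewrite mJ eqxx.
Qed.

Lemma card_ltn (i : 'I_k.+1) : #|[set l : 'I_k.+1 | (l < i)%N]| = i.
Proof. by rewrite cardsE -sum1_card (big_ord_narrow (ltnW (ltn_ord i))) sum1_card card_ord. Qed.

(* The sign makes the coboundary a plain sum, and the adjoint coboundary a difference. *)
Definition psi i x : R := (-1) ^+ i * phi (face x [set i]).

Lemma psi_upd i x g : psi i (upd x i g) = psi i x.
Proof.
rewrite /psi; congr (_ * phi _); apply/eqP/face_eqP; split=> // l.
by rewrite inE ffunE => /negbTE ->.
Qed.

(** A facet has every colour, so restoring colour i carries the sign (-1)^i, the one built into
    [psi i]. *)
Lemma cob_face x : (\prod_i x i)%g \in A ->
  cob col F k phi (face x finset.set0) = \sum_i psi i x.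
Proof.
move=> xA; rewrite /cob !inE face_colorful card_face finset.setC0 cardsT card_ord eqxx /=.
rewrite prodS_face xA.
rewrite (big_supp (h := fun i => face x [set i]) (Q := xpredT)).
- apply: eq_bigr => i _; rewrite -(finset.setU0 [set i]) inc_face ?inE // finset.setU0.
  congr (_ ^+ _ * _); rewrite -[RHS](card_ltn i); apply: eq_card => l.
  by rewrite !inE.
- by move=> i j _ _ /eqP/face_eqP[/set1_inj].
- move=> i _; rewrite !inE face_colorful card_face cardsC1 card_ord eqxx /=.
  by rewrite ltn_eqF.
move=> S _; rewrite mulf_eq0 negb_or => /andP[/inc_neq0[[i g] iS E] _].
have : (i, g) \in face x finset.set0 by rewrite E !inE eqxx.
rewrite inE /= => /andP[_ /eqP gE]; exists i => //.
rewrite -[LHS](setU1K iS) -E gE (faceU1 x (J := finset.set0) (i := i)) ?inE //.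
by rewrite finset.setU0 setU1K // !inE eqxx.
Qed.

Definition ssum i j x : R := \sum_h psi i (upd x j h).

(** Restoring colour i has sign (-1)^i and gives a face missing j; restoring j has sign (-1)^(j-1),
    colour i being absent. With the signs of [psi j] and [psi i] the exponents i+j and i+j-1 differ
    by one, whence a difference; squaring removes the common sign. *)
Lemma cobadj_face x i j : (0 < k)%N -> (i < j)%N ->
  cobadj col F k.-1 phi (face x [set i; j]) ^+ 2 = (ssum i j x - ssum j i x) ^+ 2.
Proof.
move=> k0 ij; have ji : (j == i) = false by rewrite -val_eqE gtn_eqF.
have ij' : (i == j) = false by rewrite eq_sym.
have cc : #|~: [set i; j]| = k.-1.
  by have := cardsC [set i; j]; rewrite card_ord cards2 ij'; lia.
rewrite /cobadj !inE face_colorful card_face cc eqxx /= prednK // [k.-1 == _]ltn_eqF; last by lia.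
have addi l m g : l != m -> (l, g) |: face x (l |: [set m]) = face (upd x l g) [set m].
  move=> lm; rewrite (faceU1 _ (J := [set m]) (i := l)) ?inE // ffunE eqxx; congr (_ |: _).
  apply/eqP/face_eqP; split=> // a; rewrite !inE ffunE negb_or => /andP[/negbTE -> //].
rewrite (big_supp (h := fun v => v |: face x [set i; j]) (Q := fun v : vtx k gT => v.1 \in [set i; j])).
- rewrite (_ : \sum_(v | _) _ = \sum_(l in [set i; j]) \sum_g
      inc R col ((l, g) |: face x [set i; j]) (face x [set i; j])
      * phi ((l, g) |: face x [set i; j])); last first.
    by rewrite pair_big_dep; apply: eq_big => -[l g]; rewrite ?andbT.
  have faceu l m g : face x (l |: [set m]) = face (upd x l g) (l |: [set m]).
    by apply/eqP/face_eqP; split=> // a; rewrite !inE ffunE negb_or => /andP[/negbTE -> //].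
  have part l m : l != m -> \sum_g inc R col ((l, g) |: face x (l |: [set m])) (face x (l |: [set m]))
      * phi ((l, g) |: face x (l |: [set m]))
      = (-1) ^+ (#|[set a : 'I_k.+1 | (a \notin [set m]) && (a < l)%N]| + m) * ssum m l x.
    move=> lm; rewrite /ssum mulr_sumr; apply: eq_bigr => g _.
    rewrite addi // (faceu l m g) inc_face ?inE // /psi mulrA exprD -!mulrA; congr (_ * _).
    by rewrite mulrA -expr2 sqrr_sign mul1r.
  rewrite big_setU1 ?inE ?ij' //= big_set1 part ?ij' //.
  have -> : [set i; j] = j |: [set i] by rewrite finset.setUC.
  rewrite part ?ji //.
  have -> : #|[set a : 'I_k.+1 | (a \notin [set j]) && (a < i)%N]| = i.
    rewrite -[RHS](card_ltn i); apply: eq_card => a; rewrite !inE -val_eqE /=; lia.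
  have -> : #|[set a : 'I_k.+1 | (a \notin [set i]) && (a < j)%N]| = j.-1.
    rewrite -[in RHS](card_ltn j) (cardsD1 i [set a : 'I_k.+1 | (a < j)%N]) inE ij /=.
    by apply: eq_card => a; rewrite !inE.
  have -> : (i + j)%N = (j.-1 + i).+1 by lia.
  rewrite [(-1) ^+ (j.-1 + i).+1]exprS; set e := (-1) ^+ (j.-1 + i); have e2 : e ^+ 2 = 1 by exact: sqrr_sign.
  transitivity (e ^+ 2 * (ssum i j x - ssum j i x) ^+ 2); first by ring.
  by rewrite e2 mul1r.
- move=> [a g] [b h] aI bI E; have aJ : a \in [set i; j] by exact: aI.
  have : (a, g) \in (b, h) |: face x [set i; j] by rewrite -E !inE eqxx.
  by rewrite 2!inE inE /= aJ orbF => /eqP.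
- move=> [a g] /= aJ.
  have [b ->] : exists b, (a, g) |: face x [set i; j] = face (upd x a g) [set b].
    move: aJ; rewrite !inE => /orP[]/eqP ->; first by exists j; rewrite addi ?ij'.
    by exists i; rewrite [[set i; j]]finset.setUC addi ?ji.
  by rewrite !inE face_colorful card_face cardsC1 card_ord eqxx ltn_eqF.
move=> S; rewrite !inE => /andP[colS _]; rewrite mulf_eq0 negb_or => /andP[/inc_neq0[[a g] aS E] _].
(* A new vertex of a colour already present would give S two vertices of that colour. *)
exists (a, g) => //=; apply: contraNT aS => aJ.
have aF : (a, x a) \in face x [set i; j] by rewrite inE /= aJ eqxx.
have agS : (a, g) \in S by rewrite E !inE eqxx.
have axS : (a, x a) \in S by rewrite E inE aF orbT.
move: colS => /forall_inP/(_ _ agS)/forall_inP/(_ _ axS).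
by rewrite /= eqxx => /eqP ->.
Qed.

Definition sqn i : R := \sum_x psi i x ^+ 2.
Let inA x : R := ((\prod_l x l)%g \in A)%:R.

Lemma sum_phi2 : (\sum_(S in F k) phi S ^+ 2) * n = \sum_i sqn i.
Proof.
have := sum_faces (fun S => phi S ^+ 2) (leqnSn k); rewrite subSnn expr1 sum_card1 => E.
rewrite (eq_bigl (fun S : {set vtx k gT} => colorful S && (#|S| == k))); last first.
  by move=> S; rewrite !inE [k == _]ltn_eqF // andbT.
rewrite E; apply: eq_bigr => i _; apply: eq_bigr => x _.
by rewrite /psi exprMn sqrr_sign mul1r.
Qed.

Lemma sum_cob2 : \sum_(S in F k.+1) cob col F k phi S ^+ 2
  = \sum_x inA x * (\sum_i psi i x) ^+ 2.
Proof.
have := sum_faces (fun S => (prodS S \in A)%:R * cob col F k phi S ^+ 2) (leqnn k.+1).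
rewrite subnn expr0 mulr1 => E.
transitivity (\sum_(S : {set vtx k gT} | colorful S && (#|S| == k.+1))
    (prodS S \in A)%:R * cob col F k phi S ^+ 2).
  rewrite [RHS](bigID (fun S => prodS S \in A)) /= [X in _ + X]big1 ?addr0; last first.
    by move=> S /andP[_ /negbTE ->]; rewrite mul0r.
  apply: eq_big => [S|S]; first by rewrite !inE eqxx /= andbA.
  by rewrite !inE eqxx => /and3P[_ _ /= ->]; rewrite mul1r.
rewrite E (big_pred1 finset.set0); last by move=> J; rewrite cards_eq0.
apply: eq_bigr => x _; rewrite prodS_face /inA; case: (boolP (_ \in A)) => xA; last by rewrite !mul0r.
by rewrite cob_face.
Qed.

Lemma sum_cobadj2 : (0 < k)%N ->
  (\sum_(S in F k.-1) cobadj col F k.-1 phi S ^+ 2) * n ^+ 2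
  = \sum_(i < k.+1) \sum_(j < k.+1 | (i < j)%N) \sum_x (ssum i j x - ssum j i x) ^+ 2.
Proof.
move=> k0; have := sum_faces (fun S => cobadj col F k.-1 phi S ^+ 2) (_ : (k.-1 <= k.+1)%N).
move=> /(_ ltac:(lia)); rewrite (_ : (k.+1 - k.-1)%N = 2%N); last by lia.
rewrite sum_card2 => E.
rewrite (eq_bigl (fun S : {set vtx k gT} => colorful S && (#|S| == k.-1))); last first.
  by move=> S; rewrite !inE [k.-1 == _]ltn_eqF ?andbT //; lia.
rewrite E; apply: eq_bigr => i _; apply: eq_bigr => j ij; apply: eq_bigr => x _.
exact: cobadj_face.
Qed.

(** As [psi i] ignores x_i, that coordinate may be resampled, and the product then falls in A for
    exactly |A| values. *)
Lemma sum_diag i : n * (\sum_x inA x * psi i x ^+ 2) = #|A|%:R * sqn i.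
Proof.
rewrite -(sum_upd _ i) /sqn mulr_sumr; apply: eq_bigr => x _.
have [a [c E]] := prod_upd1 x i.
under eq_bigr => g _ do rewrite psi_upd /inA E.
rewrite -mulr_suml; congr (_ * _).
rewrite (sum_translate (fun g => (g \in A)%:R)) -sumr_const [RHS]big_mkcond /=.
by apply: eq_bigr => g _; case: (g \in A).
Qed.

(** A norm bound for the centred convolution kernel, with the two squared norms added rather than
    multiplied, so that it can be summed over x. *)
Variable th : R.
Hypothesis biA : forall u v : gT -> R,
  2 * (\sum_g \sum_h ((g * h \in A)%g%:R - #|A|%:R / n) * (u g * v h))
  <= th * (\sum_g u g ^+ 2 + \sum_h v h ^+ 2).

(** Translating u and v absorbs the constants a, b, c without changing sums or norms; replacing u by
    -u turns the upper bound into a lower one. *)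
Lemma bilinear_lower (a b c : gT) (u v : gT -> R) :
  2 * (#|A|%:R / n * ((\sum_g u g) * (\sum_h v h))) - th * (\sum_g u g ^+ 2 + \sum_h v h ^+ 2)
  <= 2 * \sum_g \sum_h (a * g * b * h * c \in A)%g%:R * (u g * v h).
Proof.
pose u' g := u (a^-1 * g * b^-1)%g; pose v' h := v (1 * h * c^-1)%g.
have := biA (fun g => - u' g) v'.
under [X in _ <= th * (X + _)]eq_bigr => g _ do rewrite sqrrN.
rewrite /u' /v' (sum_translate (fun g => u g ^+ 2)) (sum_translate (fun g => v g ^+ 2)).
have -> : \sum_g \sum_h (a * g * b * h * c \in A)%g%:R * (u g * v h)
   = \sum_g \sum_h (g * h \in A)%g%:R * (u' g * v' h).
  rewrite -(sum_translate (fun g => \sum_h (g * h \in A)%g%:R * (u' g * v' h)) a b).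
  apply: eq_bigr => g _.
  rewrite -(sum_translate (fun h => (a * g * b * h \in A)%g%:R * (u' (a * g * b)%g * v' h)) 1%g c).
  by apply: eq_bigr => h _; rewrite /u' /v' !mul1g !mulgA !mulgK mulVg mul1g.
have -> : (\sum_g u g) * (\sum_h v h) = \sum_g \sum_h u' g * v' h.
  rewrite -(sum_translate u a^-1 b^-1) -(sum_translate v 1%g c^-1) mulr_suml.
  by apply: eq_bigr => g _; rewrite mulr_sumr.
have -> : \sum_g \sum_h ((g * h \in A)%g%:R - #|A|%:R / n) * (- u' g * v' h)
  = #|A|%:R / n * (\sum_g \sum_h u' g * v' h) - \sum_g \sum_h (g * h \in A)%g%:R * (u' g * v' h).
  rewrite mulr_sumr -sumrB; apply: eq_bigr => g _.
  by rewrite mulr_sumr -sumrB; apply: eq_bigr => h _; ring.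
lra.
Qed.

(** Resampling x_i and x_j costs the factor n^2. For fixed x, [psi j] is then a function of x_i
    alone and [psi i] of x_j alone, so [bilinear_lower] applies. *)
Lemma sum_cross i j : (i < j)%N ->
  2 * (#|A|%:R / n) * (\sum_x ssum i j x * ssum j i x) - th * n * (sqn i + sqn j)
  <= 2 * (n ^+ 2 * (\sum_x inA x * (psi i x * psi j x))).
Proof.
move=> ij; have nij : i != j by rewrite -val_eqE neq_ltn ij.
have -> : n ^+ 2 * (\sum_x inA x * (psi i x * psi j x)) = \sum_x \sum_g \sum_h
   inA (upd (upd x i g) j h) * (psi j (upd x i g) * psi i (upd x j h)).
  rewrite expr2 -mulrA -(sum_upd _ j) -(sum_upd _ i); apply: eq_bigr => x _.
  apply: eq_bigr => g _; apply: eq_bigr => h _.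
  by rewrite psi_upd {2}updC // psi_upd [psi i _ * _]mulrC.
have sq l m : n * sqn l = \sum_x \sum_g psi l (upd x m g) ^+ 2.
  by rewrite (sum_upd (fun x => psi l x ^+ 2)).
rewrite (_ : th * n * _ = th * (n * sqn i + n * sqn j)); last by ring.
rewrite (sq i j) (sq j i) -big_split !mulr_sumr -sumrB.
apply: ler_sum => x _ /=.
have [a [b [c E]]] := prod_upd2 x ij.
have := bilinear_lower a b c (fun g => psi j (upd x i g)) (fun h => psi i (upd x j h)).
rewrite -/(ssum i j x) -/(ssum j i x).
rewrite (_ : \sum_g \sum_h (_ * g * _ * h * _ \in A)%g%:R * _ = \sum_g \sum_h
   inA (upd (upd x i g) j h) * (psi j (upd x i g) * psi i (upd x j h))).
  lra.
by apply: eq_bigr => g _; apply: eq_bigr => h _; rewrite /inA E.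
Qed.

Lemma dirichlet_lower : (0 < k)%N ->
  (#|A|%:R - k%:R * th) * (\sum_(S in F k) phi S ^+ 2)
  <= \sum_(S in F k) phi S * lap col F k phi S.
Proof.
move=> k0; have n0 : 0 < n by rewrite ltr0n; apply/card_gt0P; exists 1%g.
have kE : k = k.-1.+1 by rewrite prednK.
have en : \sum_(S in F k) phi S * lap col F k phi S
  = \sum_(r in F k.-1) cobadj col F k.-1 phi r ^+ 2 + \sum_(t in F k.+1) cob col F k phi t ^+ 2.
  by have := energy col F k.-1 phi; rewrite -kE.
have expand : n ^+ 2 * (\sum_x inA x * (\sum_i psi i x) ^+ 2)
   = n * (#|A|%:R * \sum_i sqn i) + \sum_(i < k.+1) \sum_(j < k.+1 | (i < j)%N)
      2 * (n ^+ 2 * (\sum_x inA x * (psi i x * psi j x))).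
  have -> : \sum_x inA x * (\sum_i psi i x) ^+ 2
    = \sum_i \sum_j \sum_x inA x * (psi i x * psi j x).
    under [RHS]eq_bigr => i _ do rewrite exchange_big /=.
    rewrite [RHS]exchange_big; apply: eq_bigr => x _ /=.
    rewrite expr2 mulr_suml mulr_sumr; apply: eq_bigr => i _.
    by rewrite !mulr_sumr.
  under eq_bigr => i _ do rewrite (bigD1 i) //=.
  rewrite big_split /= mulrDr; congr (_ + _).
    rewrite expr2 -mulrA; congr (_ * _); rewrite !mulr_sumr; apply: eq_bigr => i _.
    by rewrite -sum_diag; congr (_ * _); apply: eq_bigr => x _; rewrite expr2.
  rewrite sum_offdiag mulr_sumr; apply: eq_bigr => i _.
  rewrite mulr_sumr; apply: eq_bigr => j _.
  rewrite mulrDr mulr_natl mulr2n; congr (_ + _ * _).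
  by apply: eq_bigr => x _; rewrite [psi i x * _]mulrC.
have count : k%:R * (\sum_i sqn i) = \sum_(i < k.+1) \sum_(j < k.+1 | (i < j)%N) (sqn i + sqn j).
  rewrite -(sum_offdiag (fun i _ => sqn i)) mulr_sumr; apply: eq_bigr => i _.
  rewrite sumr_const mulr_natl; congr (_ *+ _).
  have := cardC1 i; rewrite card_ord /= => e; apply: etrans (esym e) _.
  by apply: eq_card => j; rewrite !inE.
have c0 : 0 <= #|A|%:R / n by rewrite divr_ge0 ?ler0n.
have c1 : #|A|%:R / n <= 1 by rewrite ler_pdivrMr // mul1r ler_nat max_card.
have pairs : 0 <= \sum_(i < k.+1) \sum_(j < k.+1 | (i < j)%N) (\sum_x (ssum i j x - ssum j i x) ^+ 2
    + 2 * (n ^+ 2 * (\sum_x inA x * (psi i x * psi j x))) + th * n * (sqn i + sqn j)).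
  apply: sumr_ge0 => i _; apply: sumr_ge0 => j ij.
  have := sum_cross ij; set T := 2 * (n ^+ 2 * _).
  suff : 0 <= \sum_x (ssum i j x - ssum j i x) ^+ 2
      + 2 * (#|A|%:R / n) * (\sum_x ssum i j x * ssum j i x) by lra.
  rewrite mulr_sumr -big_split; apply: sumr_ge0 => x _ /=.
  set c := _ / n in c0 c1 *; set u := ssum _ _ _; set v := ssum _ _ _.
  (* Here the adjoint coboundary pays for the constant kernel: with c = m/n in [0, 1] both terms are
     nonnegative. *)
  have -> : (u - v) ^+ 2 + 2 * c * (u * v) = (1 - c) * (u - v) ^+ 2 + c * (u ^+ 2 + v ^+ 2) by ring.
  apply: addr_ge0; apply: mulr_ge0; rewrite ?subr_ge0 ?sqr_ge0 //.
  by apply: addr_ge0; exact: sqr_ge0.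
rewrite en sum_cob2 -(ler_pM2l (exprn_gt0 2 n0)).
set N := \sum_(S in F k) _; set D1 := \sum_(r in _) _.
have -> : n ^+ 2 * ((#|A|%:R - k%:R * th) * N) = n * (#|A|%:R * (N * n)) - th * n * (k%:R * (N * n)) by ring.
rewrite mulrDr expand [n ^+ 2 * D1]mulrC sum_cobadj2 // sum_phi2 count.
have split3 (a b c : 'I_k.+1 -> 'I_k.+1 -> R) :
    \sum_(i < k.+1) \sum_(j < k.+1 | (i < j)%N) (a i j + b i j + th * n * c i j)
    = \sum_(i < k.+1) \sum_(j < k.+1 | (i < j)%N) a i j + \sum_(i < k.+1) \sum_(j < k.+1 | (i < j)%N) b i j
      + th * n * \sum_(i < k.+1) \sum_(j < k.+1 | (i < j)%N) c i j.
  rewrite mulr_sumr -!big_split; apply: eq_bigr => i _ /=.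
  by rewrite mulr_sumr -!big_split.
by rewrite split3 in pairs; lra.
Qed.

Lemma eig_lower (l : R) : (0 < k)%N -> (forall S, S \notin F k -> phi S = 0) ->
  (exists S, phi S != 0) -> (forall S, lap col F k phi S = l * phi S) ->
  #|A|%:R - k%:R * th <= l.
Proof.
move=> k0 sup [S0 nz] eig.
have pos : 0 < \sum_(S in F k) phi S ^+ 2.
  have S0F : S0 \in F k by apply: contraNT nz => /sup ->.
  rewrite (bigD1 S0) //= ltr_pwDl ?exprn_even_gt0 //.
  by apply: sumr_ge0 => S _; exact: sqr_ge0.
rewrite -(ler_pM2r pos); apply: le_trans (dirichlet_lower k0) _.
rewrite mulr_sumr le_eqVlt; apply/orP; left; apply/eqP; apply: eq_bigr => S _.
by rewrite eig; ring.
Qed.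
End Complex.

(** * Existence of eigenvalues *)

Section RealSymmetric.
Local Open Scope complex_scope.

(** An eigenvector exists over the algebraically closed field R[i]; symmetry forces its eigenvalue
    to be real, and then its real or imaginary part is a real eigenvector. *)
Lemma sym_real_eigenvector (R : rcfType) d (A : 'M[R]_d) : (0 < d)%N -> A^T = A ->
  exists l (v : 'rV[R]_d), v != 0 /\ v *m A = l *: v.
Proof.
move=> d0 symA.
have [a /eigenvalueP[w wA w0]] :=
  eigenvalue_closed (map_mx (real_complex R) A) d0.
pose x := map_mx (@complex.Re R) w; pose y := map_mx (@complex.Im R) w.
pose al := complex.Re a; pose be := complex.Im a.
have entry j : \sum_i w 0 i * (A i j)%:C = a * w 0 j.
  have := congr1 (fun B : 'rV_d => B 0 j) wA; rewrite !mxE => <-.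
  by apply: eq_bigr => i _; rewrite mxE.
have Ex : x *m A = al *: x - be *: y.
  apply/rowP => j; rewrite !mxE; have := congr1 (@complex.Re R) (entry j).
  rewrite raddf_sum /= => E; transitivity (complex.Re (a * w 0 j)).
    rewrite -E; apply: eq_bigr => i _; rewrite !mxE /=.
    by case: (w 0 i) => ? ? /=; ring.
  by rewrite /al /be; case: (a) (w 0 j) => ? ? [].
have Ey : y *m A = al *: y + be *: x.
  apply/rowP => j; rewrite !mxE; have := congr1 (@complex.Im R) (entry j).
  rewrite raddf_sum /= => E; transitivity (complex.Im (a * w 0 j)).
    rewrite -E; apply: eq_bigr => i _; rewrite !mxE /=.
    by case: (w 0 i) => ? ? /=; ring.
  by rewrite /al /be; case: (a) (w 0 j) => ? ? [].
have nrm (v : 'rV[R]_d) : (v *m v^T) 0 0 = \sum_j v 0 j ^+ 2.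
  by rewrite mxE; apply: eq_bigr => j _; rewrite mxE expr2.
have nrm0 (v : 'rV[R]_d) : (v *m v^T) 0 0 = 0 -> v = 0.
  rewrite nrm => /psumr_eq0P z; apply/rowP => j; rewrite mxE.
  by apply/eqP; rewrite -sqrf_eq0 z // => i _; rewrite sqr_ge0.
have nrm_ge0 (v : 'rV[R]_d) : 0 <= (v *m v^T) 0 0.
  by rewrite nrm sumr_ge0 // => j _; rewrite sqr_ge0.
(* Compares the two bracketings of x A y^T: one gives - be |y|^2, the other be |x|^2, besides the
   common term. *)
have be0 : be * ((x *m x^T) 0 0 + (y *m y^T) 0 0) = 0.
  have := congr1 (fun B : 'M_1 => B 0 0) (mulmxA x A y^T).
  have -> : A *m y^T = (y *m A)^T by rewrite trmx_mul symA.
  rewrite Ex Ey [(_ + _)^T]linearD /= ![(_ *: _)^T]linearZ /= mulmxDr mulmxBl -!scalemxAr -!scalemxAl !mxE; lra.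
have xy : (x != 0) || (y != 0).
  apply: contraNT w0; rewrite negb_or !negbK => /andP[/eqP x0 /eqP y0].
  apply/eqP/rowP => j; rewrite mxE.
  have := congr1 (fun B : 'rV_d => B 0 j) x0; have := congr1 (fun B : 'rV_d => B 0 j) y0.
  by rewrite !mxE; case: (w 0 j) => ? ? /= -> ->.
have {}be0 : be = 0.
  move/eqP: be0; rewrite mulf_eq0 => /orP[/eqP //|]; rewrite paddr_eq0 //.
  by case/andP=> /eqP/nrm0 x0 /eqP/nrm0 y0; rewrite x0 y0 eqxx in xy.
move: Ex Ey; rewrite be0 !scale0r subr0 addr0 => Ex Ey.
by case/orP: xy => ?; [exists al, x | exists al, y].
Qed.
End RealSymmetric.

(** [mineig] is an infimum, and a lower bound on eigenvalues passes to it only if some eigenvalue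
    exists. *)
Lemma eigs_nonempty (R : realType) (V : finType) (col : V -> nat) (F : nat -> {set {set V}}) p :
  (0 < #|F p.+1|)%N -> exists l, eigs (R := R) col F p.+1 l.
Proof.
move=> F0; have [S0 S0F] : exists S, S \in F p.+1 by apply/card_gt0P.
pose e (i : 'I_#|F p.+1|) : {set V} := enum_val i.
have eF i : e i \in F p.+1 by exact: enum_valP.
pose M : 'M[R]_#|F p.+1| := \matrix_(i, j) lapK R col F p (e i) (e j).
have symM : M^T = M.
  apply/matrixP => i j; rewrite !mxE /lapK.
  by congr (_ + _); apply: eq_bigr => S _; rewrite mulrC.
have [l [v [v0 vM]]] := sym_real_eigenvector F0 symM.
pose phi S : R := if S \in F p.+1 then v 0 (enum_rank_in S0F S) else 0.
have phie i : phi (e i) = v 0 i by rewrite /phi eF enum_valK_in.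
exists l, phi; split=> [S /negbTE SF||S]; first by rewrite /phi SF.
  case: (boolP [exists i, v 0 i != 0]) => [/existsP[i vi]|]; first by exists (e i); rewrite phie.
  rewrite negb_exists => /forallP z; case/eqP: v0; apply/rowP => i; rewrite mxE.
  by apply/eqP; rewrite -[_ == _]negbK z.
have [SF|SF] := boolP (S \in F p.+1); last first.
  by rewrite /lap /= /cob /cobadj /phi (negbTE SF) mulr0 addr0.
rewrite lap_kernel // -(enum_rankK_in S0F SF); set s := enum_rank_in S0F S.
rewrite -/(e s) phie big_enum_val /=.
have := congr1 (fun B : 'rV_#|F p.+1| => B 0 s) vM; rewrite !mxE => <-.
apply: eq_bigr => i _; rewrite -/(e i) phie mulrC; congr (_ * _).
by rewrite -symM !mxE.
Qed.

(** * The dilated convolution operator *)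

Section Operator.
Variables (R : realType) (gT : finGroupType).
Let n : R := #|gT|%:R.
Let d := #|{: bool * gT}|.

(* The matrix ([x y = a] - 1/n)_(x, y) is made symmetric by acting on two copies of G,
   exchanging them; [opX a] is this Hermitian dilation. *)
Definition oprod (p q : bool * gT) : gT := if p.1 then (q.2 * p.2)%g else (p.2 * q.2)%g.

Definition kern (a : gT) (p q : bool * gT) : R :=
  if p.1 == q.1 then 0 else (oprod p q == a)%:R - n^-1.

Definition opX (a : gT) : 'M[R]_d := \matrix_(i, j) kern a (enum_val i) (enum_val j).

Lemma kernC a p q : kern a p q = kern a q p.
Proof.
rewrite /kern eq_sym; case: eqP => // ne; rewrite /oprod.
by case: p q ne => [[] x] [[] y].
Qed.

Let n_gt0 : 0 < n.
Proof. by rewrite ltr0n; apply/card_gt0P; exists 1%g. Qed.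

Lemma sum_boolgT (f : bool * gT -> R) :
  \sum_p f p = \sum_x f (false, x) + \sum_x f (true, x).
Proof.
transitivity (\sum_b \sum_x f (b, x)); first by rewrite pair_big; apply: eq_bigr => -[].
by rewrite big_bool addrC.
Qed.

Lemma sum_index (f : bool * gT -> R) : \sum_(i < d) f (enum_val i) = \sum_p f p.
Proof. by rewrite [RHS](reindex (fun i : 'I_d => enum_val i)) //; exact: onW_bij (enum_val_bij _). Qed.

Lemma opX_sym a : (opX a)^T = opX a.
Proof. by apply/matrixP => i j; rewrite !mxE kernC. Qed.

Lemma opX_sum : \sum_a opX a = 0.
Proof.
apply/matrixP => i j; rewrite summxE mxE; under eq_bigr => a _ do rewrite mxE /kern.
case: ((enum_val i).1 == _); first by rewrite big1.
rewrite sumrB sumr_const -[n^-1 *+ _]mulr_natr mulVf ?gt_eqF //.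
rewrite (bigD1 (oprod (enum_val i) (enum_val j))) //= eqxx big1 ?addr0 ?subrr // => a.
by rewrite eq_sym => /negbTE ->.
Qed.

(** The variance is at most the second moment, and the bijection s does not affect the sum. *)
Lemma centered_le (f : gT -> R) (s : gT -> gT) : injective s ->
  \sum_x (f (s x) - (\sum_y f y) / n) ^+ 2 <= \sum_x f x ^+ 2.
Proof.
move=> injs; have -> : \sum_x (f (s x) - (\sum_y f y) / n) ^+ 2
   = \sum_x (f x - (\sum_y f y) / n) ^+ 2.
  by rewrite [RHS](reindex_inj injs).
set c := _ / n; have cE : \sum_y f y = n * c by rewrite /c mulrC divfK ?gt_eqF.
rewrite (eq_bigr (fun x => f x ^+ 2 - 2 * c * f x + c ^+ 2)); last by move=> x _; ring.
rewrite big_split sumrB /= sumr_const -mulr_sumr cE -mulr_natl -/n.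
have := mulr_ge0 (ltW n_gt0) (sqr_ge0 c); lra.
Qed.

(** For given x the equation defining the kernel has one solution y in the other copy, so [opX a]
    exchanges the copies, permutes each and subtracts the mean. *)
Lemma kern_apply a (f : bool * gT -> R) b x :
  \sum_q kern a (b, x) q * f q
  = f (~~ b, if b then (a * x^-1)%g else (x^-1 * a)%g) - (\sum_y f (~~ b, y)) / n.
Proof.
have main (y0 : gT) (e : gT -> bool) (g : gT -> R) : (forall y, e y = (y == y0)) ->
    \sum_y ((e y)%:R - n^-1) * g y = g y0 - (\sum_y g y) / n.
  move=> eE; under eq_bigr => y _ do rewrite mulrBl eE.
  rewrite sumrB -mulr_sumr [n^-1 * _]mulrC; congr (_ - _).
  by rewrite (bigD1 y0) //= eqxx mul1r big1 ?addr0 // => y /negbTE ->; rewrite mul0r.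
rewrite sum_boolgT /kern /oprod /=; case: b => /=.
  rewrite [X in _ + X]big1 ?addr0; last by move=> y _; rewrite mul0r.
  apply: main => y; apply/eqP/eqP => [<-|->]; by rewrite ?mulgK ?mulgKV.
rewrite [X in X + _]big1 ?add0r; last by move=> y _; rewrite mul0r.
apply: main => y; apply/eqP/eqP => [<-|->]; by rewrite ?mulKg ?mulKVg.
Qed.

Lemma opX_contr a (Y : 'M[R]_d) : frob (opX a *m Y) (opX a *m Y) <= frob Y Y.
Proof.
rewrite /frob exchange_big [leRHS]exchange_big; apply: ler_sum => j _ /=.
pose f p := Y (enum_rank p) j.
have fE i : Y i j = f (enum_val i) by rewrite /f enum_valK.
have E i : (opX a *m Y) i j = \sum_q kern a (enum_val i) q * f q.
  by rewrite mxE -sum_index; apply: eq_bigr => l _; rewrite mxE fE.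
under eq_bigr => i _ do rewrite E -expr2.
under [leRHS]eq_bigr => i _ do rewrite fE -expr2.
rewrite (sum_index (fun p => (\sum_q kern a p q * f q) ^+ 2)) (sum_index (fun p => f p ^+ 2)).
rewrite !sum_boolgT addrC; apply: lerD.
  under eq_bigr => x _ do rewrite kern_apply /=.
  apply: (centered_le (fun x => f (false, x)) (s := fun x => a * x^-1)%g).
  by move=> x y /mulgI/invg_inj.
under eq_bigr => x _ do rewrite kern_apply /=.
apply: (centered_le (fun x => f (true, x)) (s := fun x => x^-1 * a)%g).
by move=> x y /mulIg/invg_inj.
Qed.

(** The contrapositive of [quad_trace] for the vector with u on one copy of G and v on the other;
    each of the two off-diagonal blocks contributes the bilinear form once. *)
Lemma trace_bilinear (A : {set gT}) (th : R) q : 0 <= th ->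
  \tr (subsum opX A ^+ q.*2) < th ^+ q.*2 -> forall u v : gT -> R,
  2 * (\sum_g \sum_h ((g * h \in A)%g%:R - #|A|%:R / n) * (u g * v h))
  <= th * (\sum_g u g ^+ 2 + \sum_h v h ^+ 2).
Proof.
move=> th0 small u v.
pose f (p : bool * gT) := if p.1 then v p.2 else u p.2.
pose w : 'cV[R]_d := \col_i f (enum_val i).
have ww : frob w w = \sum_g u g ^+ 2 + \sum_h v h ^+ 2.
  rewrite /frob; under eq_bigr => i _ do rewrite big_ord1 mxE -expr2.
  by rewrite (sum_index (fun p => f p ^+ 2)) sum_boolgT.
pose kA p q : R := if p.1 == q.1 then 0 else (oprod p q \in A)%:R - #|A|%:R / n.
have SE i j : subsum opX A i j = kA (enum_val i) (enum_val j).
  rewrite /subsum summxE; under eq_bigr => a _ do rewrite mxE /kern.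
  rewrite /kA; case: ((enum_val i).1 == _); first by rewrite big1.
  rewrite sumrB sumr_const -[n^-1 *+ _]mulr_natl; congr (_ - _).
  set z := oprod _ _; case: (boolP (z \in A)) => zA.
    by rewrite (bigD1 z) //= eqxx big1 ?addr0 // => a /andP[_]; rewrite eq_sym => /negbTE ->.
  by rewrite big1 // => a aA; case: eqP => // za; rewrite za aA in zA.
have wSw : frob w (subsum opX A *m w)
    = 2 * (\sum_g \sum_h ((g * h \in A)%g%:R - #|A|%:R / n) * (u g * v h)).
  rewrite /frob; under eq_bigr => i _ do rewrite big_ord1 !mxE.
  transitivity (\sum_p f p * \sum_q kA p q * f q).
    rewrite -sum_index; apply: eq_bigr => i _; congr (_ * _).
    by rewrite -sum_index; apply: eq_bigr => j _; rewrite SE mxE.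
  rewrite sum_boolgT mulr_natl mulr2n; congr (_ + _).
    apply: eq_bigr => g _; rewrite sum_boolgT [X in X + _]big1 ?add0r.
      by rewrite mulr_sumr; apply: eq_bigr => h _; rewrite /f /kA /oprod /=; ring.
    by move=> h _; rewrite /kA /= mul0r.
  rewrite exchange_big; apply: eq_bigr => h _; rewrite sum_boolgT [X in _ + X]big1 ?addr0.
    by rewrite mulr_sumr; apply: eq_bigr => g _; rewrite /f /kA /oprod /=; ring.
  by move=> g _; rewrite /kA /= mul0r.
rewrite -ww -wSw leNgt; apply/negP => lt.
have symS : (subsum opX A)^T = subsum opX A by apply: subsum_sym; exact: opX_sym.
by have := quad_trace q symS th0 lt; rewrite leNgt small.
Qed.
End Operator.

(** * From traces to the probability bound *)

Lemma mu_lower (R : realType) (k : nat) (gT : finGroupType) (A : {set gT}) (th : R) q :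
  (0 < k)%N -> 0 <= th -> \tr (subsum (opX R (gT := gT)) A ^+ q.*2) < th ^+ q.*2 ->
  #|A|%:R - k%:R * th <= muY R k A.
Proof.
move=> k0 th0 small; apply: lb_le_inf.
  case: k k0 => // k _; apply: eigs_nonempty.
  apply/card_gt0P; exists (face [ffun=> 1%g] [set ord0]).
  by rewrite !inE face_colorful card_face cardsC1 card_ord eqxx ltn_eqF.
move=> l [phi [sup nz eig]].
exact: (eig_lower (trace_bilinear th0 small) k0 sup nz eig).
Qed.

(** The squares of the irreducible degrees add up to |G|, and the other products in the square of
    their sum are nonnegative. *)
Lemma card_le_DG2 (gT : finGroupType) : (#|gT| <= DG gT ^ 2)%N.
Proof.
have := irr_sum_square [set: gT]%G; rewrite cardsT /DG.
have E (i : Iirr [set: gT]%G) : 'chi_i 1%g = (Num.truncn ('chi_i 1%g : algC))%:R :> algC.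
  by apply/esym/eqP; rewrite -natrEtruncn Cnat_irr1.
under eq_bigr => i _ do rewrite E -natrX.
rewrite -natr_sum => /eqP; rewrite eqr_nat => /eqP <-.
set f := fun i => _; rewrite -mulnn big_distrlr /=; apply: leq_sum => i _.
by rewrite (bigD1 i) //= -mulnn leq_addr.
Qed.

(** Markov's inequality by counting: a bad A has trace at least th^(2q), and every other trace is
    nonnegative. The factor 2n is the dimension of the dilation. *)
Lemma bad_card_le (R : realType) (k : nat) (gT : finGroupType) (th : R) (m q : nat) :
  (0 < k)%N -> 0 <= th -> (m <= #|gT|)%N -> (q.*2 <= m)%N ->
  #|[set A : {set gT} | (#|A| == m) && (muY R k A < m%:R - k%:R * th)]|%:R * th ^+ q.*2
  <= 'C(#|gT|, m)%:R * (2 * #|gT|%:R * (\prod_(i < q) (i.*2.+1)%:R) * m%:R ^+ q).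
Proof.
move=> k0 th0 mn qm.
have symS A : (subsum (opX R (gT := gT)) A)^T = subsum (opX R (gT := gT)) A.
  by apply: subsum_sym; exact: opX_sym.
have le := moment_le (@opX_sym R gT) (@opX_contr R gT) (opX_sum R gT) mn qm.
have dE : #|{: bool * gT}|%:R = 2 * #|gT|%:R :> R by rewrite card_prod card_bool natrM.
rewrite natrM dE in le.
rewrite !mulrA; apply: le_trans (le_trans _ le) _; last by rewrite !mulrA.
rewrite /moment (bigID (fun A => muY R k A < m%:R - k%:R * th)) /=.
rewrite mulr_natl -sumr_const big_set -[leLHS]addr0; apply: lerD.
  apply: ler_sum => A /andP[/eqP cA bad]; rewrite leNgt; apply/negP => small.
  by have := mu_lower k0 th0 small; rewrite cA leNgt bad.
apply: sumr_ge0 => A _; have := frob_ge0 (subsum (opX R (gT := gT)) A ^+ q).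
by rewrite frobE trmxX symS mulmxE -exprD addnn.
Qed.

Theorem theorem1p4 (R : realType) (k : nat) (eps : R) (gT : finGroupType) :
  (1 <= k)%N -> 0 < eps -> eps < 1 ->
  10 ^+ 6 * (k%:R / eps) ^+ 8 < (#|gT|%:R : R) ->
  let n := #|gT| in
  let m := `|Num.ceil (9 * k%:R ^+ 2 * ln ((DG gT)%:R : R) / eps ^+ 2)|%N in
  (#|[set A : {set gT} | (#|A| == m) && (muY R k A < (1 - eps) * m%:R)]|%:R
     / #|[set A : {set gT} | #|A| == m]|%:R : R)
  < 6 / n%:R.
Proof.
move=> k1 e0 e1 big; cbv zeta.
set n := #|gT| in big *; set m := `|Num.ceil _|%N.
have k1R : 1 <= k%:R :> R by rewrite ler1n.
have k0R : 0 < k%:R :> R by lra.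
have ke : 1 <= k%:R / eps by rewrite ler_pdivlMr // mul1r; lra.
have n6 : 10 ^+ 6 < n%:R :> R.
  by apply: le_lt_trans big; rewrite ler_peMr ?exprn_ge0 // exprn_ege1.
have n0 : 0 < n%:R :> R by apply: lt_trans n6; rewrite exprn_gt0.
(* If m > n there are no m-subsets; the denominator is 0, its inverse is 0 by convention, and the
   ratio is 0. *)
rewrite card_draws -/n; have [mn|nm] := leqP m n; last first.
  by rewrite bin_small // invr0 mulr0 divr_gt0.
have D1 : (0 < DG gT)%N.
  rewrite lt0n; apply/eqP => D0; have := card_le_DG2 gT; rewrite D0 leqn0 -(eqr_nat R) -/n.
  by rewrite gt_eqF.
have lnD : 0 <= ln (DG gT)%:R :> R by rewrite ln_ge0 // ler1n.
have lnn : ln n%:R <= 2 * ln (DG gT)%:R :> R.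
  rewrite mulr_natl -lnXn ?ltr0n // ler_ln ?posrE ?exprn_gt0 ?ltr0n //; last by rewrite -(ltr0n R).
  by rewrite -natrX ler_nat card_le_DG2.
have mge : 9 * k%:R ^+ 2 * ln ((DG gT)%:R : R) / eps ^+ 2 <= m%:R.
  set y := _ / _; have y0 : 0 <= y by rewrite divr_ge0 ?mulr_ge0 ?exprn_ge0 // ltW.
  have c0 : 0 <= Num.ceil y by rewrite ceil_ge0; lra.
  by rewrite /m -/y natr_absz ger0_norm // ceil_ge.
clearbody m.
pose t : R := m%:R * eps ^+ 2 / k%:R ^+ 2.
have tn : 9 / 2 * ln n%:R <= t.
  apply: (@le_trans _ _ (9 * ln (DG gT)%:R)); first by lra.
  rewrite /t ler_pdivlMr ?exprn_gt0 //; move: mge; rewrite ler_pdivrMr ?exprn_gt0 //; lra.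
(* From eps < 1 <= k; it yields 2q <= m, as the moment bound requires. *)
have tm : t <= m%:R.
  rewrite /t -mulrA ler_piMr // ler_pdivrMr ?exprn_gt0 // mul1r.
  by rewrite lerXn2r ?nnegrE //; lra.
have lnn0 : 0 < ln n%:R :> R by rewrite ln_gt0 //; apply: lt_trans n6; lra.
have t0 : 0 < t by lra.
pose q := Num.truncn (t / 2).
have qle : q%:R * 2 <= t by rewrite -ler_pdivlMr // truncn_le; lra.
have qm : (q.*2 <= m)%N by rewrite -(ler_nat R) -muln2 natrM; lra.
(* Chosen so that k th = eps m; then th^2 = t m, and the factor m^q cancels below. *)
pose th : R := eps * m%:R / k%:R.
have th0 : 0 <= th by rewrite divr_ge0 ?mulr_ge0 // ltW.
have m0 : 0 < m%:R :> R by lra.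
have thE : th ^+ q.*2 = t ^+ q * m%:R ^+ q.
  rewrite -mul2n exprM -exprMn; congr (_ ^+ _); rewrite /th /t; field; lra.
have := bad_card_le k1 th0 mn qm.
rewrite (_ : m%:R - k%:R * th = (1 - eps) * m%:R); last by rewrite /th; field; lra.
set bad := #|_|; rewrite thE !mulrA ler_pM2r ?exprn_gt0 // => le.
have C0 : 0 < 'C(n, m)%:R :> R by rewrite ltr0n bin_gt0.
rewrite ltr_pdivrMr // -(ltr_pM2r (exprn_gt0 q t0)).
have tail := tail_small n6 tn (erefl q); rewrite -(ltr_pM2l C0) in tail.
rewrite -/n in le; apply: le_lt_trans le _.
by move: tail; rewrite (mulrC (6 / _) 'C(n, m)%:R) !mulrA.
Qed.
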